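(* For $(i,j)\in\{1,\dots,k_1\}\times\{1,\dots,k_2\}$, let $f_{i,j}(x,y)=(ax+t_i,\,by+u_j)$, where $0<a<b<1$ and $t_i,u_j\in\mathbb{R}$. For $i=1,2$, let $\overline{\nu}_i$ be a Borel probability measure on $\{1,\dots,k_i\}^{\mathbb{N}}$ such that, for some constant $K$, $$\overline{\nu}_i([uv])\le K\,\overline{\nu}_i([u])\,\overline{\nu}_i([v])$$ for all finite words $u\in\{1,\dots,k_i\}^m$, $v\in\{1,\dots,k_i\}^n$. Let $\nu_i$ be the projection (push-forward) of $\overline{\nu}_i$ under the respective coding map. If $\log a/\log b$ is irrational, then for every $q\in(1,2]$ and all $t>0$, $$D_q(\nu_1*A_t\nu_2)=\min(D_q(\nu_1)+D_q(\nu_2),1),$$ where $A_t(x)=tx$, and moreover $$-\frac{\log\mathcal{C}^q_{\nu_1*A_t\nu_2}(n)}{(q-1)n}\to\min(D_q(\nu_1)+D_q(\nu_2),1)\quad\text{as } n\to\infty,$$ uniformly for $t$ in compact subsets of $(0,+\infty)$.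
   Context: For a finite word $u$, $[u]$ is the set of infinite words starting with $u$; $uv$ denotes concatenation. The coding maps are those of the iterated function systems $\{x\mapsto ax+t_i\}_{i=1}^{k_1}$ (for $\nu_1$) and $\{x\mapsto bx+u_j\}_{j=1}^{k_2}$ (for $\nu_2$) on $\mathbb{R}$: an infinite word $(w_1,w_2,\dots)$ is mapped to $\lim_{n\to\infty}h_{w_1}\circ\cdots\circ h_{w_n}(0)$, where $h_1,h_2,\dots$ are the maps of the system. The convolution $\rho_1*\rho_2$ is the push-forward of $\rho_1\times\rho_2$ under $(x,y)\mapsto x+y$, and $A_t\nu_2$ is the push-forward of $\nu_2$ under $A_t$. Logarithms are to base $2$. For a Borel probability measure $\rho$ on $\mathbb{R}$, $\mathcal{C}^q_\rho(n)=\sum_{I\in\mathfrak{D}_n}\rho(I)^q$, where $\mathfrak{D}_n=\{[2^{-n}j,2^{-n}(j+1)): j\in\mathbb{Z}\}$, and for $q>1$ the $L^q$ dimension is $D_q(\rho)=\lim_{n\to\infty}\frac{\log\mathcal{C}^q_\rho(n)}{-n(q-1)}$ when the limit exists. The existence of all $L^q$ dimensions mentioned is part of the conclusion. *)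

(* Defs.v *)
From HB Require Import structures.
From mathcomp Require Import all_boot all_order all_algebra.
From mathcomp Require Import all_classical all_reals all_analysis.
From mathcomp Require Import measurable_realfun.

Set Implicit Arguments.
Unset Strict Implicit.
Unset Printing Implicit Defensive.

Import Order.TTheory GRing.Theory Num.Theory.
Import numFieldNormedType.Exports.

Local Open Scope classical_set_scope.
Local Open Scope ring_scope.

HB.instance Definition _ (k : nat) := isPointed.Build 'I_k.+1 ord0.

(* Measurable types are pointed, so an alphabet with k >= 1 letters is written
   'I_k'.+1 where k = k'.+1; letters and positions are numbered from 0.
   [tree_of] carries the product topology of the discrete topologies. *)
Notation words k := (g_sigma_algebraType (@open (tree_of (fun=> 'I_k.+1)))).

Definition cylinder (k : nat) (u : seq 'I_k.+1) : set (words k) :=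
  [set w | mkseq w (size u) = u].

Section measurable_limn.
Context {d} {T : measurableType d} {R : realType}.

Let cvgn_cauchyE (u : R^nat) : cvgn u <->
  forall k, exists N, forall m, (N <= m)%N -> `|u N - u m| < k.+1%:R^-1.
Proof.
split=> [/cvgrPdist_lt cu k|cu].
  have k0 : (0 : R) < k.+1%:R^-1 / 2 by rewrite divr_gt0 ?invr_gt0.
  have [N _ hN] := cu _ k0; exists N => m Nm.
  rewrite (splitr (k.+1%:R^-1)) -(subrKA (limn u)) (le_lt_trans (ler_normD _ _))//.
  by rewrite ltrD // ?[`|u N - _|]distrC; apply: hN => /=.
apply: R_complete; apply: cauchy_exP => e e0.
have [k ke] := ltr_add_invr e0; have [N hN] := cu k.
exists (u N); exists N => // m /= Nm; rewrite /ball /=.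
by apply: lt_trans (hN m Nm) _; rewrite add0r in ke.
Qed.

Lemma measurable_limn (f : (T -> R)^nat) :
  (forall n, measurable_fun [set: T] (f n)) ->
  measurable_fun [set: T] (fun x => limn (f^~ x)).
Proof.
move=> mf; pose C := [set x | cvgn (f^~ x)].
have mC : measurable C.
  rewrite (_ : C = \bigcap_k \bigcup_N \bigcap_(m in [set m | N <= m]%N)
      [set x | `|f N x - f m x| < k.+1%:R^-1]); last first.
    apply/seteqP; split=> [x /cvgn_cauchyE Cx k _|x Cx].
      by have [N hN] := Cx k; exists N.
    by apply/cvgn_cauchyE => k; have [N _ hN] := Cx k I; exists N.
  apply: bigcapT_measurable => k; apply: bigcup_measurable => N _.
  apply: bigcap_measurable => [|m _]; first by exists N => /=.
  have mg : measurable_fun [set: T] (fun x => `|f N x - f m x|).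
    by apply: measurableT_comp => //; exact: measurable_funB.
  have := mg measurableT `]-oo, k.+1%:R^-1[%classic (measurable_itv _).
  by rewrite setTI; congr measurable; apply/seteqP; split=> x /=;
    rewrite in_itv.
rewrite -(setUv C); apply/measurable_funU => //; first exact: measurableC.
split; first by apply: (measurable_fun_cvg (h := f)) => [m|x //]; exact: measurable_funTS.
apply: (eq_measurable_fun (cst point)) => [x|]; last exact: measurable_cst.
rewrite inE /= => nC; apply/esym/getPN => l fl; apply: nC.
by apply/cvg_ex; exists l.
Qed.

End measurable_limn.

Section coding.
Context {R : realType} {k : nat}.
Variables (a : R) (t : 'I_k.+1 -> R).

(* h_{u_1} o ... o h_{u_n} (0) where h_i (x) = a x + t_i *)
Definition compose_word (u : seq 'I_k.+1) : R :=
  foldr (fun i x => a * x + t i) 0 u.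

Definition coding (w : words k) : R :=
  limn (fun n => compose_word (mkseq w n)).

Let measurable_letter (m : nat) :
  measurable_fun [set: words k] (fun w : words k => t (w m)).
Proof.
move=> _ B mB; rewrite setTI; apply: sub_sigma_algebra.
have cw : continuous ((fun w => w m) :
    tree_of (fun=> 'I_k.+1) -> discrete_topology 'I_k.+1).
  exact: (@proj_continuous _ (fun=> discrete_topology 'I_k.+1) m).
by move/continuousP : cw => /(_ (t @^-1` B)); apply; exact: discrete_open.
Qed.

Let measurable_compose (n : nat) :
  measurable_fun [set: words k] (fun w : words k => compose_word (mkseq w n)).
Proof.
rewrite /mkseq; elim: n 0%N => [|n ih] m /=; first exact: measurable_cst.
by apply: measurable_funD; [apply: measurable_funM|exact: measurable_letter].
Qed.

Lemma measurable_coding : measurable_fun [set: words k] coding.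
Proof. exact: measurable_limn. Qed.

HB.instance Definition _ :=
  isMeasurableFun.Build _ _ (words k) R coding measurable_coding.

End coding.

Definition projection {R : realType} {k : nat} (a : R) (t : 'I_k.+1 -> R)
    (P : probability (words k) R) : probability R R :=
  distribution P (coding a t).

Definition submultiplicative {R : realType} {k : nat}
    (P : probability (words k) R) : Prop :=
  exists K : R, forall u v : seq 'I_k.+1,
    (P (cylinder (u ++ v)) <= K%:E * (P (cylinder u) * P (cylinder v)))%E.

Section convolution.
Context {R : realType}.

Definition addpair (z : R * R) : R := z.1 + z.2.

Let measurable_addpair : measurable_fun [set: R * R] addpair.
Proof. exact: measurable_funD. Qed.

HB.instance Definition _ :=
  isMeasurableFun.Build _ _ (R * R)%type R addpair measurable_addpair.

Definition convolution (mu nu : probability R R) : probability R R :=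
  distribution (mu \x nu)%E addpair.

Definition dilation (t : R) (x : R) : R := t * x.

Let measurable_dilation t : measurable_fun [set: R] (dilation t).
Proof. exact: measurable_funM. Qed.

HB.instance Definition _ t :=
  isMeasurableFun.Build _ _ R R (dilation t) (measurable_dilation t).

Definition dilate (t : R) (nu : probability R R) : probability R R :=
  distribution nu (dilation t).

End convolution.

Section Lq_dimension.
Context {R : realType}.

Definition log2 (x : R) : R := ln x / ln 2.

Definition dyadic (n : nat) : set (set R) :=
  [set `[2 ^- n * j%:~R, 2 ^- n * (j + 1)%:~R[%classic | j in [set: int]].

(* The sum lies in [0, 1] when 1 <= q, so that [fine] loses nothing. *)
Definition Lq_sum (rho : probability R R) (q : R) (n : nat) : R :=
  fine (\esum_(I in dyadic n) (rho I `^ q)%E).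

Definition Lq_quotient (rho : probability R R) (q : R) (n : nat) : R :=
  log2 (Lq_sum rho q n) / - (n%:R * (q - 1)).

Definition Lq_dim (rho : probability R R) (q : R) : R :=
  limn (Lq_quotient rho q).

End Lq_dimension.

(* Main.v *)
Require Import Defs.
From HB Require Import structures.
From mathcomp Require Import all_boot all_order all_algebra.
From mathcomp Require Import all_classical all_reals all_analysis.
From mathcomp Require Import measurable_realfun.
From mathcomp Require Import zify ring lra.
From mathcomp Require finmap.

Set Implicit Arguments.
Unset Strict Implicit.
Unset Printing Implicit Defensive.

Import Order.TTheory GRing.Theory Num.Theory.
Import numFieldNormedType.Exports.

Local Open Scope classical_set_scope.
Local Open Scope ring_scope.

(** Write E(s, n) for the L^q sum at scale 2^-n of nu1 * A_s nu2, and E1(n),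
    E2(n) for those of nu1 and nu2; constants below do not depend on n, and are
    uniform for s in bounded sets.

    The dimension is at most the minimum.  Grouping cells can only increase a
    sum of q-th powers of masses, so E(s, n) >= c E1(n) E2(n); and the measure
    sits on O(2^n) cells, so E(s, n) >= c 2^(-n(q-1)) by convexity.

    For the other direction, cut the words after m letters for nu1 and after l
    letters for nu2, with a^m comparable to 2^-n.  The hypothesis on the measures
    of cylinders gives the cocycle inequality
      E(s, n + n') <= C E(s, n) E(s', n')   where s' = s b^l / a^m
    ([conv_sum_cocycle]).  At s = 0 the convolution is nu1 itself, ln E1 is
    subadditive up to a constant, and D_q(nu1) exists by Fekete's lemma; D_q(nu2)
    exists for the same reason.  For s > 0 choose l so that s' falls back into
    a fundamental domain for the multiplication by b.  In the coordinate ln s the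
    passage from s to s' is then a rotation of a circle of length -ln b by
    -m ln a, an irrational angle.

    It remains to see that along every orbit of this rotation the mean of
    ln E(., n) is at most -n(q-1) ln 2 (min(D1 + D2, 1) - eps), where D_i is the
    dimension of nu_i and n is large in terms of eps.  By Dirichlet's theorem
    some k-th iterate of the rotation moves points by at most 2^-n without fixing
    them, so a long orbit splits into k progressions that go once
    round the circle with tiny equal steps.  Along such a progression the mean of
    E(., n) is controlled by a discrete form of the projection theorem of
    Marstrand, for the L^q dimension with 1 < q <= 2 as in Hunt and Kaloshin
    ([conv_sum_mean]), and the mean of ln E is at most the logarithm of the mean
    of E.  This bounds a whole block of the orbit in terms of n only
    ([G_orbit_gain]); iterating the block gives an exponential rate that does not
    depend on the starting point, whence the uniform convergence.

    All estimates are made on finite families of weighted points, the words of a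
    given length; [Lq_sum_approx] passes between them and the measures. *)

(** * Convexity inequalities for real powers *)

Section powers.
Context {R : realType}.
Implicit Types (q x y : R).

Lemma powR_split q x : 1 < q -> 0 <= x -> x `^ q = x * x `^ (q - 1).
Proof. by move=> q1 x0; rewrite mulr_powRB1// (lt_trans ltr01). Qed.

Lemma le_powR q x y : 0 <= q -> 0 <= x -> x <= y -> x `^ q <= y `^ q.
Proof.
by move=> q0 x0 xy; apply: ge0_ler_powR => //; rewrite nnegrE// (le_trans x0).
Qed.

(** Young's inequality for x and y^(q-1), rearranged: a convex function lies
    above its tangents. *)
Lemma powR_tangent q x y : 1 < q -> 0 <= x -> 0 <= y ->
  y `^ q + q * y `^ (q - 1) * (x - y) <= x `^ q.
Proof.
move=> q1 x0 y0.
have q0 : 0 < q by rewrite (lt_trans ltr01).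
have qn0 : q != 0 by rewrite gt_eqF.
have q10 : 0 < q - 1 by rewrite subr_gt0.
have q1n0 : q - 1 != 0 by rewrite gt_eqF.
have p0 : 0 < q / (q - 1) by rewrite divr_gt0.
have Y0 : 0 <= y `^ (q - 1) by exact: powR_ge0.
have := conjugate_powR x0 Y0 q0 p0.
rewrite -powRrM mulrCA divff// mulr1.
have -> : q^-1 + (q / (q - 1))^-1 = 1 by field; rewrite q1n0 qn0.
move=> /(_ erefl).
have yE : y `^ q = y * y `^ (q - 1) by rewrite powR_split.
have -> : x `^ q / q + y `^ q / (q / (q - 1)) =
  (x `^ q + (q - 1) * y `^ q) / q by field; rewrite q1n0 qn0.
rewrite ler_pdivlMr// yE; nra.
Qed.

(** Sum the tangent inequality at the barycentre of the x_i. *)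
Lemma powR_Jensen (I : eqType) (s : seq I) (P : pred I) (w x : I -> R) q : 1 < q ->
  (forall i, P i -> 0 <= w i) -> (forall i, P i -> 0 <= x i) ->
  (\sum_(i <- s | P i) w i * x i) `^ q <=
  (\sum_(i <- s | P i) w i) `^ (q - 1) * \sum_(i <- s | P i) w i * x i `^ q.
Proof.
move=> q1 w0 x0; set W := \sum_(i <- s | P i) w i; set S := \sum_(i <- s | P i) _ * _.
have W0 : 0 <= W by apply: sumr_ge0.
have S0 : 0 <= S by apply: sumr_ge0 => i Pi; rewrite mulr_ge0 ?w0 ?x0.
have [W00|Wn0] := eqVneq W 0.
  have -> : S = 0.
    apply: big1_seq => i /andP[Pi si].
    have /eqP := W00; rewrite psumr_eq0// => /allP /(_ i si); rewrite Pi /= => /eqP ->.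
    by rewrite mul0r.
  by rewrite powR0 ?gt_eqF ?(lt_trans ltr01)// mulr_ge0 ?powR_ge0// sumr_ge0// => i Pi;
    rewrite mulr_ge0 ?powR_ge0 ?w0.
have Wgt0 : 0 < W by rewrite lt_neqAle eq_sym Wn0.
pose Y := S / W.
have Y0 : 0 <= Y by rewrite divr_ge0.
have key : W * Y `^ q <= \sum_(i <- s | P i) w i * x i `^ q.
  have -> : W * Y `^ q = \sum_(i <- s | P i) w i * (Y `^ q + q * Y `^ (q - 1) * (x i - Y)).
    have SE : S = W * Y by rewrite /Y mulrCA divff// mulr1.
    pose C := q * Y `^ (q - 1).
    transitivity (W * (Y `^ q - C * Y) + S * C); first by rewrite SE; ring.
    rewrite /W /S !mulr_suml -big_split /=.
    by apply: eq_bigr => i _; rewrite -/C; ring.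
  by apply: ler_sum => i Pi; rewrite ler_wpM2l ?w0// powR_tangent// ?x0.
have -> : S `^ q = W `^ (q - 1) * (W * Y `^ q).
  rewrite mulrA [_ * W]mulrC -powR_split// -powRM//.
  by rewrite /Y mulrCA divff// mulr1.
by rewrite ler_wpM2l ?powR_ge0.
Qed.

(** A crude bound through the largest term.  It holds for every q > 0, and its
    constant is only ever applied to boundedly many terms, or to the n + 1 scales
    below 1, where a factor polynomial in n is harmless. *)
Lemma powR_sum_le (I : finType) (P : pred I) (y : I -> R) q : 0 < q ->
  (forall i, P i -> 0 <= y i) ->
  (\sum_(i | P i) y i) `^ q <= #|I|%:R `^ q * \sum_(i | P i) y i `^ q.
Proof.
move=> q0 y0.
have [i0 Pi0|Pe] := pickP P; last first.
  by rewrite !big_pred0// powR0 ?gt_eqF// mulr0.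
pose m := [arg max_(i > i0 | P i) y i]%O.
have [Pm ym] : P m /\ forall j, P j -> y j <= y m.
  by rewrite /m; case: arg_maxP.
apply: (@le_trans _ _ ((#|I|%:R * y m) `^ q)).
  apply: le_powR; [exact: ltW|by apply: sumr_ge0|].
  apply: (@le_trans _ _ (\sum_(i | P i) y m)); first exact: ler_sum.
  by rewrite sumr_const -(mulr_natl (y m)) ler_wpM2r ?y0// ler_nat max_card.
rewrite powRM ?y0// ler_wpM2l ?powR_ge0// (bigD1 m)//= lerDl.
by apply: sumr_ge0 => *; exact: powR_ge0.
Qed.

End powers.

(** * Sums of powers of the masses of fibres *)

Section fibre_sums.
Context {R : realType}.
Variable q : R.
Hypothesis q1 : 1 < q.

Definition fibre_mass (X : finType) (T : eqType) (p : X -> R) (c : X -> T) (j : T) : R :=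
  \sum_(x | c x == j) p x.

(** The sum of the q-th powers of the masses of the fibres of c.  Written as a
    sum over the points rather than over the values of c, it makes sense for
    any codomain and is visibly monotone in the fibres. *)
Definition fibre_sum (X : finType) (T : eqType) (p : X -> R) (c : X -> T) : R :=
  \sum_x p x * fibre_mass p c (c x) `^ (q - 1).

(** The mass within M cells of the cell of x: a discrete version of the mass of
    a ball. *)
Definition ball_mass (X : finType) (p : X -> R) (c : X -> int) (M : nat) (x : X) : R :=
  \sum_(y | `|c y - c x| <= M%:Z) p y.

Definition ball_sum (X : finType) (p : X -> R) (c : X -> int) (M : nat) : R :=
  \sum_x p x * ball_mass p c M x `^ (q - 1).

(** The loss when the masses of cells are spread over 2 M + 1 neighbours: the
    exponent q comes from the power of a sum, the extra 1 from the number of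
    shifts. *)
Definition smear_const (M : nat) : R := (M.*2.+1)%:R `^ (q + 1).

Let q0 : 0 < q. Proof. exact: lt_trans q1. Qed.
Let q10 : 0 <= q - 1. Proof. by rewrite subr_ge0 ltW. Qed.

Lemma smear_const_gt0 M : 0 < smear_const M.
Proof. by rewrite powR_gt0. Qed.

Lemma fibre_mass_ge0 (X : finType) (T : eqType) (p : X -> R) (c : X -> T) j :
  (forall x, 0 <= p x) -> 0 <= fibre_mass p c j.
Proof. by move=> p0; apply: sumr_ge0. Qed.

Lemma fibre_sum_ge0 (X : finType) (T : eqType) (p : X -> R) (c : X -> T) :
  (forall x, 0 <= p x) -> 0 <= fibre_sum p c.
Proof. by move=> p0; apply: sumr_ge0 => x _; rewrite mulr_ge0 ?powR_ge0. Qed.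

Lemma ball_mass_ge0 (X : finType) (p : X -> R) (c : X -> int) M x :
  (forall x, 0 <= p x) -> 0 <= ball_mass p c M x.
Proof. by move=> p0; apply: sumr_ge0. Qed.

Lemma sum_fibres (X : finType) (T : eqType) (c : X -> T) (f : X -> R) (s : seq T) :
  uniq s ->
  \sum_(j <- s) \sum_(x | c x == j) f x = \sum_(x | c x \in s) f x.
Proof.
move=> us.
under eq_bigr do rewrite big_mkcond /=.
rewrite exchange_big /= [RHS]big_mkcond /=; apply: eq_bigr => x _.
case: ifPn => cs.
  rewrite (bigD1_seq (c x))//= eqxx big1_seq ?addr0// => j /andP[jx _].
  by rewrite eq_sym (negbTE jx).
rewrite big1_seq// => j /andP[_ js]; case: ifPn => // /eqP E.
by rewrite E js in cs.
Qed.

Lemma sum_fibre_massM (X : finType) (T : eqType) (p : X -> R) (c : X -> T)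
    (g : T -> R) (s : seq T) : uniq s ->
  \sum_(j <- s) fibre_mass p c j * g j = \sum_(x | c x \in s) p x * g (c x).
Proof.
move=> us; rewrite -sum_fibres//; apply: eq_bigr => j _.
by rewrite mulr_suml; apply: eq_bigr => x /eqP ->.
Qed.

Lemma fibre_sum_ge (X : finType) (T : eqType) (p : X -> R) (c : X -> T) (s : seq T) :
  (forall x, 0 <= p x) -> uniq s ->
  \sum_(j <- s) fibre_mass p c j `^ q <= fibre_sum p c.
Proof.
move=> p0 us.
under eq_bigr do rewrite powR_split ?fibre_mass_ge0//.
rewrite (sum_fibre_massM _ _ (fun j => fibre_mass p c j `^ (q - 1)))//.
rewrite /fibre_sum [leRHS](bigID (fun x => c x \in s)) /= lerDl.
by apply: sumr_ge0 => x _; rewrite mulr_ge0 ?powR_ge0.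
Qed.

Lemma fibre_sumE (X : finType) (T : eqType) (p : X -> R) (c : X -> T) (s : seq T) :
  (forall x, 0 <= p x) -> uniq s -> (forall x, c x \in s) ->
  fibre_sum p c = \sum_(j <- s) fibre_mass p c j `^ q.
Proof.
move=> p0 us cs.
under [RHS]eq_bigr do rewrite powR_split ?fibre_mass_ge0//.
rewrite (sum_fibre_massM _ _ (fun j => fibre_mass p c j `^ (q - 1)))//.
by apply: eq_bigl => x; rewrite cs.
Qed.

Definition cells (X : finType) (T : eqType) (c : X -> T) : seq T :=
  undup [seq c x | x <- enum X].

Lemma mem_cells (X : finType) (T : eqType) (c : X -> T) x : c x \in cells c.
Proof. by rewrite mem_undup map_f// mem_enum. Qed.

Definition shifts (M : nat) (j : int) (i : 'I_M.*2.+1) : int := j + (i%:Z - M%:Z).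

(** The bound on B is required of every finite set of indices, so that it is
    invariant under the translations j |-> j + i that this proof sums over. *)
Lemma smear (A B : int -> R) (M : nat) (S : R) :
  (forall j, 0 <= A j) -> (forall j, 0 <= B j) ->
  (forall j, A j <= \sum_(i < M.*2.+1) B (shifts j i)) ->
  (forall s : seq int, uniq s -> \sum_(j <- s) B j `^ q <= S) ->
  forall s : seq int, uniq s -> \sum_(j <- s) A j `^ q <= smear_const M * S.
Proof.
move=> A0 B0 AB BS s us.
apply: (@le_trans _ _ (\sum_(j <- s) (M.*2.+1)%:R `^ q *
    \sum_(i < M.*2.+1) B (shifts j i) `^ q)).
  apply: ler_sum => j _.
  apply: (@le_trans _ _ ((\sum_(i < M.*2.+1) B (shifts j i)) `^ q)).
    by apply: le_powR => //; exact: ltW.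
  by have := @powR_sum_le _ 'I_M.*2.+1 xpredT (fun i => B (shifts j i)) q q0
    (fun i _ => B0 _); rewrite card_ord.
rewrite -mulr_sumr exchange_big /=.
rewrite /smear_const powRD ?powRr1//; last by rewrite pnatr_eq0 implybT.
rewrite -mulrA ler_wpM2l ?powR_ge0//.
apply: (@le_trans _ _ (\sum_(i < M.*2.+1) S)).
  apply: ler_sum => i _.
  rewrite -(big_map (fun j => shifts j i) xpredT (fun j => B j `^ q)).
  by apply: BS; rewrite map_inj_uniq// /shifts => x y /addIr.
by rewrite sumr_const card_ord mulr_natl.
Qed.

Lemma ball_mass_shifts (X : finType) (p : X -> R) (c : X -> int) M (j : int) :
  (forall x, 0 <= p x) ->
  \sum_(y | `|c y - j| <= M%:Z) p y <= \sum_(i < M.*2.+1) fibre_mass p c (shifts j i).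
Proof.
move=> p0; rewrite /fibre_mass.
rewrite -(big_map (shifts j) xpredT (fun k => \sum_(y | c y == k) p y)).
rewrite sum_fibres; last first.
  rewrite map_inj_uniq ?index_enum_uniq// => x y /addrI /addIr [] xy.
  exact: val_inj.
rewrite big_mkcond [leRHS]big_mkcond /=; apply: ler_sum => y _.
case: ifPn => [h|_]; last by case: ifP.
rewrite ifT//.
have hi : (absz (c y - j + M%:Z)%R < M.*2.+1)%N by lia.
apply/mapP; exists (Ordinal hi); first by rewrite mem_index_enum.
by rewrite /shifts /=; lia.
Qed.

(** Doubling does not affect these sums: although an individual ball may be much
    heavier than its central cell, its mass is recovered in the neighbouring
    cells. *)
Lemma ball_sum_le (X : finType) (p : X -> R) (c : X -> int) M :
  (forall x, 0 <= p x) -> ball_sum p c M <= smear_const M * fibre_sum p c.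
Proof.
move=> p0; pose W (j : int) := \sum_(y | `|c y - j| <= M%:Z) p y.
have W0 j : 0 <= W j by apply: sumr_ge0.
apply: (@le_trans _ _ (\sum_(j <- cells c) W j `^ q)); last first.
  apply: (@smear _ (fibre_mass p c)) => //; last by exact: undup_uniq.
  - by move=> j; exact: fibre_mass_ge0.
  - by move=> j; exact: ball_mass_shifts.
  - by move=> s us; exact: fibre_sum_ge.
rewrite /ball_sum.
have -> : \sum_x p x * ball_mass p c M x `^ (q - 1) =
    \sum_(j <- cells c) fibre_mass p c j * W j `^ (q - 1).
  rewrite (sum_fibre_massM _ _ (fun j => W j `^ (q - 1))) ?undup_uniq//.
  by apply: eq_bigl => x; rewrite mem_cells.
apply: ler_sum => j _; rewrite [leRHS]powR_split// ler_wpM2r ?powR_ge0//.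
rewrite /fibre_mass /W big_mkcond [leRHS]big_mkcond /=; apply: ler_sum => y _.
case: ifPn => [/eqP ->|_]; last by case: ifP.
by rewrite subrr normr0.
Qed.

(** Fibres of c sit in balls for d.  This one comparison accounts for changes of
    origin, of scale and of approximation, and for passing to a finer
    partition. *)
Lemma fibre_sum_compare (X : finType) (T : eqType) (p : X -> R) (c : X -> T)
    (d : X -> int) M : (forall x, 0 <= p x) ->
  (forall x y, c x = c y -> `|d x - d y| <= M%:Z) ->
  fibre_sum p c <= smear_const M * fibre_sum p d.
Proof.
move=> p0 cd; apply: le_trans (ball_sum_le _ _ p0).
apply: ler_sum => x _; rewrite ler_wpM2l//; apply: le_powR => //.
  exact: fibre_mass_ge0.
rewrite /fibre_mass /ball_mass big_mkcond [leRHS]big_mkcond /=; apply: ler_sum => y _.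
by case: ifPn => [/eqP /cd ->|_]//; case: ifP.
Qed.

Lemma fibre_sum_product (X X' : finType) (T T' : eqType) (p : X -> R) (p' : X' -> R)
    (c : X -> T) (c' : X' -> T') : (forall x, 0 <= p x) -> (forall x, 0 <= p' x) ->
  fibre_sum (fun x : X * X' => p x.1 * p' x.2) (fun x => (c x.1, c' x.2)) =
  fibre_sum p c * fibre_sum p' c'.
Proof.
move=> p0 p'0; rewrite /fibre_sum big_distrlr /= pair_bigA /=.
apply: eq_bigr => -[x x'] _ /=.
rewrite mulrACA -powRM ?fibre_mass_ge0//; congr (_ * _ `^ _).
rewrite /fibre_mass big_distrlr /= [RHS]pair_big /=.
by apply: eq_bigl => -[y y'] /=; rewrite xpair_eqE.
Qed.

(** Cells at a fine scale split according to the coarse point x.  For a given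
    fine cell j only those x matter which can reach j, and they are close to one
    another; Jensen's inequality over these x costs the factor ball_mass ^ (q-1),
    which recombines with the weight p x into the coarse sum. *)
Lemma fibre_sum_submul (X X' : finType) (T : eqType) (w : X * X' -> R)
    (p : X -> R) (p' : X' -> R) (c : X * X' -> T) (d : X -> int) (d' : X' -> int)
    (K : R) (M M' : nat) :
  0 <= K -> (forall x, 0 <= p x) -> (forall x, 0 <= p' x) -> (forall x, 0 <= w x) ->
  (forall x x', w (x, x') <= K * (p x * p' x')) ->
  (forall x x' y y', c (x, x') = c (y, y') -> `|d x - d y| <= M%:Z) ->
  (forall x x' y', c (x, x') = c (x, y') -> `|d' x' - d' y'| <= M'%:Z) ->
  fibre_sum w c <=
    K `^ q * smear_const M * smear_const M' * (fibre_sum p d * fibre_sum p' d').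
Proof.
move=> K0 p0 p'0 w0 wK cd cd'.
pose m j x := fibre_mass p' (fun x' => c (x, x')) j.
have m0 j x : 0 <= m j x by exact: fibre_mass_ge0.
have mass_le j : fibre_mass w c j <= K * \sum_x p x * m j x.
  rewrite /fibre_mass mulr_sumr.
  rewrite (eq_bigl (fun x => true && (c (x.1, x.2) == j))); last by case.
  rewrite (eq_bigr (fun x => w (x.1, x.2))); last by case.
  rewrite -(pair_big_dep xpredT (fun x x' => c (x, x') == j) (fun x x' => w (x, x'))) /=.
  apply: ler_sum => x _; rewrite /m /fibre_mass !mulr_sumr.
  by apply: ler_sum => x' _; rewrite wK.
have mass_pow j : fibre_mass w c j `^ q <=
    K `^ q * \sum_x p x * ball_mass p d M x `^ (q - 1) * m j x `^ q.
  apply: le_trans (_ : (K * \sum_x p x * m j x) `^ q <= _).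
    by apply: le_powR => //; [exact: ltW|exact: fibre_mass_ge0].
  rewrite powRM//; last by apply: sumr_ge0 => x _; rewrite mulr_ge0.
  rewrite ler_wpM2l ?powR_ge0//.
  (* Restricting to the active x before applying convexity is what keeps the
     total weight in powR_Jensen down to the mass of a ball. *)
  pose act x := [exists x', c (x, x') == j].
  have m_act x : ~~ act x -> m j x = 0.
    move=> /existsPn nx; rewrite /m /fibre_mass big_pred0// => x'.
    exact/negbTE.
  rewrite (bigID act) /= [X in _ + X]big1 ?addr0; last first.
    by move=> x /m_act ->; rewrite mulr0.
  apply: (le_trans (powR_Jensen _ q1 (fun i _ => p0 i) (fun i _ => m0 j i))).
  rewrite [leRHS](bigID act) /= [X in _ <= _ + X]big1 ?addr0; last first.
    by move=> x /m_act ->; rewrite powR0 ?mulr0// gt_eqF.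
  rewrite mulr_sumr; apply: ler_sum => x actx.
  rewrite mulrA ler_wpM2r ?powR_ge0// mulrC ler_wpM2l//.
  apply: le_powR => //; first exact: sumr_ge0.
  rewrite /ball_mass big_mkcond [leRHS]big_mkcond /=; apply: ler_sum => y _.
  case: ifPn => [acty|_]; last by case: ifP.
  have /existsP[x' /eqP cx] := actx; have /existsP[y' /eqP cy] := acty.
  by rewrite (cd y y' x x')// cx cy.
rewrite (@fibre_sumE _ _ _ _ (cells c))//; [|exact: undup_uniq|exact: mem_cells].
apply: (le_trans (ler_sum _ (fun j _ => mass_pow j))).
rewrite -mulr_sumr -!mulrA ler_wpM2l ?powR_ge0// exchange_big /=.
apply: (@le_trans _ _ (\sum_x p x * ball_mass p d M x `^ (q - 1) *
   (smear_const M' * fibre_sum p' d'))).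
  apply: ler_sum => x _; rewrite -mulr_sumr ler_wpM2l//.
    by rewrite mulr_ge0 ?powR_ge0.
  apply: (@le_trans _ _ (fibre_sum p' (fun x' => c (x, x')))).
    by apply: fibre_sum_ge => //; exact: undup_uniq.
  by apply: fibre_sum_compare => // x' y' /cd'.
rewrite -mulr_suml -/(ball_sum p d M).
rewrite [leRHS](_ : _ = smear_const M * fibre_sum p d * (smear_const M' * fibre_sum p' d')).
  rewrite ler_wpM2r ?ball_sum_le//.
  by rewrite mulr_ge0 ?fibre_sum_ge0// ltW// smear_const_gt0.
by rewrite mulrCA !mulrA [X in X * _]mulrC !mulrA; ring.
Qed.

(** By convexity the sum is smallest when the mass is spread equally over all
    the available cells. *)
Lemma fibre_sum_ge_card (X : finType) (T : eqType) (p : X -> R) (c : X -> T)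
    (s : seq T) : (forall x, 0 <= p x) -> \sum_x p x = 1 -> uniq s ->
  (forall x, c x \in s) -> (size s)%:R `^ (1 - q) <= fibre_sum p c.
Proof.
move=> p0 p1 us cs; rewrite (fibre_sumE p0 us cs).
have tot : \sum_(j <- s) fibre_mass p c j = 1.
  by rewrite /fibre_mass sum_fibres// -p1; apply: eq_bigl => x; rewrite cs.
have s0 : 0 < (size s)%:R :> R.
  rewrite ltr0n lt0n; apply/negP => /eqP/size0nil s0.
  by move: tot; rewrite s0 big_nil => /esym/eqP; rewrite oner_eq0.
pose y : R := (size s)%:R^-1.
have y0 : 0 <= y by rewrite invr_ge0 ltW.
apply: (@le_trans _ _
   (\sum_(j <- s) (y `^ q + q * y `^ (q - 1) * (fibre_mass p c j - y)))); last first.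
  by apply: ler_sum => j _; rewrite powR_tangent// fibre_mass_ge0.
rewrite big_split /= -mulr_sumr sumrB tot !big_const_seq count_predT !iter_addr_0.
rewrite -[y *+ _]mulr_natr /y mulVf ?gt_eqF// subrr mulr0 addr0.
rewrite (powR_split q1) ?invr_ge0 ?(ltW s0)// -mulrnAl -[_^-1 *+ _]mulr_natr mulVf ?gt_eqF// mul1r.
by rewrite -powR_inv1 ?(ltW s0)// -powRrM mulN1r opprB.
Qed.

Lemma fibre_sum_le1 (X : finType) (T : eqType) (p : X -> R) (c : X -> T) :
  (forall x, 0 <= p x) -> \sum_x p x = 1 -> fibre_sum p c <= 1.
Proof.
move=> p0 p1; rewrite -p1; apply: ler_sum => x _; rewrite ler_piMr//.
apply: (@le_trans _ _ (1 `^ (q - 1))); last by rewrite powR1.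
apply: le_powR; rewrite ?fibre_mass_ge0//.
by rewrite -p1 /fibre_mass [leRHS](bigID (fun y => c y == c x)) /= lerDl sumr_ge0.
Qed.

End fibre_sums.
(** * L^q sums of measures and of finite families *)

Section cell_sums.
Context {R : realType}.
Variable q : R.
Hypothesis q1 : 1 < q.

Definition cell (n : nat) (j : int) : set R :=
  `[2 ^- n * j%:~R, 2 ^- n * (j + 1)%:~R[%classic.

Lemma cellP n j x : cell n j x <-> Num.floor (2 ^+ n * x) = j.
Proof.
have p0 : (0 : R) < 2 ^+ n by rewrite exprn_gt0.
rewrite /cell /= in_itv /= ler_pdivrMl// ltr_pdivlMl//.
by split=> [h|<-]; [exact: floor_def|exact: floor_itv].
Qed.

Lemma measurable_cell n j : measurable (cell n j).
Proof. exact: measurable_itv. Qed.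

Lemma Lq_sumE (rho : probability R R) n :
  Lq_sum rho q n = fine (\esum_(j in [set: int]) (fine (rho (cell n j)) `^ q)%:E).
Proof.
rewrite /Lq_sum (@reindex_esum _ _ _ [set: int] (dyadic n) (cell n)); last first.
  split=> [j _|i j _ _ ij|I [j _ <-]]; [by exists j| |by exists j].
  have p0 : (0 : R) < 2 ^+ n by rewrite exprn_gt0.
  have : cell n i (2 ^- n * i%:~R) by apply/cellP; rewrite mulVKf ?gt_eqF// intrKfloor.
  by rewrite ij => /cellP; rewrite mulVKf ?gt_eqF// intrKfloor.
congr fine; apply: eq_esum => j _.
by rewrite -poweR_EFin fineK// fin_num_measure//; exact: measurable_cell.
Qed.

(** The supremum defining the L^q sum is finite as soon as the partial sums are
    bounded, and only then does [fine] preserve it. *)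
Lemma Lq_sum_le (rho : probability R R) n (S : R) :
  (forall s : seq int, uniq s -> \sum_(j <- s) fine (rho (cell n j)) `^ q <= S) ->
  Lq_sum rho q n <= S /\ forall s : seq int, uniq s ->
    \sum_(j <- s) fine (rho (cell n j)) `^ q <= Lq_sum rho q n.
Proof.
move=> hS; rewrite Lq_sumE; set E := esum _ _.
have E_le : (E <= S%:E)%E.
  apply: ge_ereal_sup => _ [X [finX _] <-].
  by rewrite fsbig_finite// sumEFin lee_fin hS// finmap.fset_uniq.
have E_ge (s : seq int) : uniq s ->
    ((\sum_(j <- s) fine (rho (cell n j)) `^ q)%:E <= E)%E.
  move=> us; apply: esum_ge; exists [set` s]; first by split=> //; exact: finite_seq.
  by rewrite -sumEFin (@fsbig_seq _ _ _ _ s)//.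
have E_fin : E \is a fin_num.
  by rewrite ge0_fin_numE ?(le_lt_trans E_le) ?ltry// esum_ge0// => j _;
    rewrite lee_fin powR_ge0.
split; first by rewrite -lee_fin fineK.
by move=> s us; rewrite -lee_fin fineK// E_ge.
Qed.

End cell_sums.

Section finite_approximation.
Context {R : realType} {d : measure_display} {Omega : measurableType d}.
Variable P : probability Omega R.

Lemma probability_fine_le (A B : set Omega) : measurable A -> measurable B ->
  A `<=` B -> fine (P A) <= fine (P B).
Proof.
move=> mA mB AB; apply: fine_le; rewrite ?fin_num_measure//.
by apply: le_measure; rewrite ?inE.
Qed.

Lemma probability_fine_sum_le (I : finType) (Q : pred I) (F : I -> set Omega)
    (A : set Omega) : measurable A -> (forall i, measurable (F i)) ->
  (forall w, A w -> exists2 i, Q i & F i w) ->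
  fine (P A) <= \sum_(i | Q i) fine (P (F i)).
Proof.
move=> mA mF AF.
have mU (s : seq I) : measurable (\big[setU/set0]_(i <- s | Q i) F i).
  by apply: bigsetU_measurable.
apply: (@le_trans _ _ (fine (P (\big[setU/set0]_(i <- index_enum I | Q i) F i)))).
  apply: probability_fine_le => // w /AF[i Qi Fi].
  by rewrite -bigcup_seq_cond; exists i => //=; rewrite mem_index_enum Qi.
elim: (index_enum I) => [|i s ih]; first by rewrite !big_nil measure0.
rewrite !big_cons; case: ifP => Qi //.
apply: (@le_trans _ _ (fine (P (F i)) + fine (P (\big[setU/set0]_(i <- s | Q i) F i)))).
  rewrite -fineD ?fin_num_measure//; apply: fine_le; last exact: measureU2.
    by rewrite fin_num_measure//; exact: measurableU.
  by rewrite fin_numD !fin_num_measure.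
by rewrite lerD2l.
Qed.

Lemma probability_fine_fibres (I : finType) (Q : pred I) (xi : Omega -> I) :
  (forall i, measurable (xi @^-1` [set i])) ->
  \sum_(i | Q i) fine (P (xi @^-1` [set i])) = fine (P [set w | Q (xi w)]).
Proof.
move=> mxi.
rewrite (_ : [set w | Q (xi w)] = \bigcup_(i in [set` Q]) (xi @^-1` [set i])); last first.
  by apply/seteqP; split=> [w Qw|w [i /= Qi wi]]; [exists (xi w)|rewrite /= wi].
rewrite measure_fin_bigcup//; last first.
  by move=> i j _ _ [w [/= wi wj]]; rewrite -wi -wj.
rewrite -(@bigfs _ _ _ _ (index_enum I)) ?index_enum_uniq//; last first.
  by move=> i _; rewrite mem_index_enum.
rewrite (eq_bigr (fun i => (fine (P (xi @^-1` [set i])))%:E)) ?sumEFin// => i _.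
by rewrite fineK// fin_num_measure.
Qed.

Variables (q : R) (rho : probability R R) (Z : Omega -> R).
Hypothesis q1 : 1 < q.
Hypothesis mZ : measurable_fun [set: Omega] Z.
Hypothesis rhoE : forall I, measurable I -> rho I = P (Z @^-1` I).

Variables (X : finType) (xi : Omega -> X) (delta : X -> int) (n M : nat).
Hypothesis mxi : forall x, measurable (xi @^-1` [set x]).
Hypothesis close : forall w, `|Num.floor (2 ^+ n * Z w) - delta (xi w)| <= M%:Z.

Let p (x : X) : R := fine (P (xi @^-1` [set x])).
Let A (j : int) : R := fine (rho (cell n j)).
Let p0 x : 0 <= p x. Proof. exact: fine_ge0. Qed.

Let mcell j : measurable (Z @^-1` cell n j).
Proof. by rewrite -[X in measurable X]setTI; apply: mZ => //; exact: measurable_cell. Qed.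

Let AE j : A j = fine (P (Z @^-1` cell n j)).
Proof. by rewrite /A rhoE//; exact: measurable_cell. Qed.

Let mdelta j : measurable [set w | delta (xi w) == j].
Proof.
rewrite (_ : [set w | _] = \bigcup_(x in [set x | delta x == j]) (xi @^-1` [set x])).
  by apply: fin_bigcup_measurable.
by apply/seteqP; split=> [w Qw|w [i /= Qi wi]]; [exists (xi w)|rewrite /= wi].
Qed.

Let A_le j : A j <= \sum_(i < M.*2.+1) fibre_mass p delta (shifts j i).
Proof.
rewrite AE.
under eq_bigr do rewrite /fibre_mass probability_fine_fibres//.
apply: probability_fine_sum_le => // w /cellP <-.
have := close w; set a := Num.floor _; set b := delta _ => ab.
have hi : (absz (b - a + M%:Z)%R < M.*2.+1)%N by lia.
by exists (Ordinal hi) => //; rewrite /shifts /=; lia.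
Qed.

Let B_le j : fibre_mass p delta j <= \sum_(i < M.*2.+1) A (shifts j i).
Proof.
under eq_bigr do rewrite AE.
rewrite /fibre_mass probability_fine_fibres//.
apply: probability_fine_sum_le => // w /= /eqP <-.
have := close w; set a := Num.floor _; set b := delta _ => ab.
have hi : (absz (a - b + M%:Z)%R < M.*2.+1)%N by lia.
by exists (Ordinal hi) => //; apply/cellP; rewrite -/a /shifts /=; lia.
Qed.

(** If Z is known up to a bounded number of cells from a variable xi with finitely
    many values, then the law of Z and the family of values of xi have comparable
    sums: each mass is at most the sum of 2 M + 1 masses of the other kind. *)
Lemma Lq_sum_approx :
  Lq_sum rho q n <= smear_const q M * fibre_sum q p delta /\
  fibre_sum q p delta <= smear_const q M * Lq_sum rho q n.
Proof.
have A0 j : 0 <= A j by exact: fine_ge0.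
have B0 j : 0 <= fibre_mass p delta j by exact: fibre_mass_ge0.
have hA := smear q1 A0 B0 A_le (fun s us => fibre_sum_ge q1 delta p0 us).
have [h1 h2] := Lq_sum_le hA; split => //.
rewrite (fibre_sumE q1 p0 (undup_uniq _) (mem_cells delta)).
by apply: (smear q1 B0 A0 B_le h2); exact: undup_uniq.
Qed.

End finite_approximation.
(** * Words, cylinders and the coding maps *)

Section words.
Context {R : realType} {k : nat}.
Variables (a : R) (t : 'I_k.+1 -> R).
Hypotheses (a0 : 0 < a) (a1 : a < 1).

(** The radius of a ball about 0 that every map x |-> a x + t_i sends into
    itself. *)
Definition word_bound : R := (\sum_i `|t i|) / (1 - a).

Lemma word_bound_ge0 : 0 <= word_bound.
Proof. by rewrite divr_ge0 ?sumr_ge0// subr_ge0 ltW. Qed.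

Lemma compose_word_bound (v : seq 'I_k.+1) : `|compose_word a t v| <= word_bound.
Proof.
elim: v => [|i v ih] /=; first by rewrite normr0 word_bound_ge0.
have ti : `|t i| <= \sum_j `|t j| by rewrite (bigD1 i)//= lerDl sumr_ge0.
apply: (@le_trans _ _ (a * word_bound + \sum_j `|t j|)).
  apply: (le_trans (ler_normD _ _)); apply: lerD => //.
  by rewrite normrM gtr0_norm// ler_wpM2l// ltW.
have a1' : 1 - a != 0 by rewrite subr_eq0 eq_sym lt_eqF.
by rewrite le_eqVlt; apply/orP; left; apply/eqP; rewrite /word_bound; field.
Qed.

Lemma compose_word_cat (v v' : seq 'I_k.+1) :
  compose_word a t (v ++ v') = compose_word a t v + a ^+ size v * compose_word a t v'.
Proof.
elim: v => [|i v ih] /=; first by rewrite add0r mul1r.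
by rewrite -/(compose_word a t _) ih exprS; ring.
Qed.

Definition segment (s m : nat) (w : words k) : m.-tuple 'I_k.+1 :=
  [tuple of mkseq (fun i => w (s + i)%N) m].

Lemma segment_cat (m m' : nat) (w : words k) :
  segment 0 (m + m') w = segment 0 m w ++ segment m m' w :> seq _.
Proof.
rewrite /segment /= /mkseq iotaD map_cat; congr (_ ++ _).
by rewrite add0n -[m in iota m]addn0 iotaDl -map_comp.
Qed.

Lemma compose_word_cauchy (w : words k) (m n : nat) : (m <= n)%N ->
  `|compose_word a t (mkseq w n) - compose_word a t (mkseq w m)| <= a ^+ m * word_bound.
Proof.
move=> mn; rewrite -(subnKC mn).
have := segment_cat m (n - m) w; rewrite /segment /= => ->.
rewrite compose_word_cat size_mkseq addrAC subrr add0r normrM.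
by rewrite normrX gtr0_norm// ler_wpM2l ?exprn_ge0 ?compose_word_bound// ltW.
Qed.

(** What follows the first m letters is contracted m times. *)
Lemma coding_approx (w : words k) (m : nat) :
  `|coding a t w - compose_word a t (segment 0 m w)| <= a ^+ m * word_bound.
Proof.
have cu : cvgn (fun n => compose_word a t (mkseq w n)).
  apply: R_complete; apply: cauchy_exP => e e0.
  have : a ^+ n * word_bound @[n --> \oo] --> 0 * word_bound.
    by apply: cvgMl; apply: cvg_expr; rewrite gtr0_norm.
  rewrite mul0r => /cvgrPdist_lt /(_ e e0)[N _ hN].
  exists (compose_word a t (mkseq w N)); exists N => // n /= Nn.
  rewrite /ball /= distrC; apply: le_lt_trans (compose_word_cauchy _ Nn) _.
  by have := hN N (leqnn N); rewrite /= sub0r normrN; apply: le_lt_trans; rewrite ler_norm.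
have cd : `|compose_word a t (mkseq w n) - compose_word a t (mkseq w m)| @[n --> \oo] -->
    `|coding a t w - compose_word a t (segment 0 m w)|.
  by apply: cvg_norm; apply: cvgB => //; exact: cvg_cst.
apply: (cvgr_to_le cd); exists m => // n /= mn; exact: compose_word_cauchy.
Qed.

Lemma measurable_letter (m : nat) (i : 'I_k.+1) : measurable [set w : words k | w m = i].
Proof.
apply: sub_sigma_algebra.
have cw : continuous ((fun w => w m) :
    tree_of (fun=> 'I_k.+1) -> discrete_topology 'I_k.+1).
  exact: (@proj_continuous _ (fun=> discrete_topology 'I_k.+1) m).
by move/continuousP : cw => /(_ [set i]); apply; exact: discrete_open.
Qed.

Lemma measurable_segment (s m : nat) (v : m.-tuple 'I_k.+1) :
  measurable (segment s m @^-1` [set v]).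
Proof.
rewrite (_ : _ @^-1` _ = \bigcap_(i in [set: 'I_m]) [set w | w (s + i)%N = tnth v i]).
  by apply: fin_bigcap_measurable => // i _; exact: measurable_letter.
apply/seteqP; split=> [w /= <- i _ /=|w /= h].
  by rewrite (tnth_nth ord0) /= nth_mkseq.
apply: eq_from_tnth => i; rewrite -(h i I).
by rewrite (tnth_nth ord0) /= nth_mkseq.
Qed.

Lemma segment_cylinder (m : nat) (v : m.-tuple 'I_k.+1) :
  segment 0 m @^-1` [set v] = cylinder v.
Proof.
apply/seteqP; split=> [w /= <-|w]; rewrite /cylinder /=.
  by rewrite size_mkseq.
by rewrite size_tuple => h; apply: val_inj => /=; rewrite -[RHS]h.
Qed.

Lemma segment2_cylinder (m m' : nat) (v : m.-tuple 'I_k.+1) (v' : m'.-tuple 'I_k.+1) :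
  [set w | segment 0 m w = v /\ segment m m' w = v'] = cylinder (v ++ v').
Proof.
apply/seteqP; split=> w; rewrite /cylinder /= size_cat !size_tuple.
  by move=> [<- <-]; rewrite -segment_cat.
have := segment_cat m m' w; rewrite /segment /= => -> /eqP.
rewrite eqseq_cat ?size_tuple ?size_mkseq// => /andP[/eqP h /eqP h'].
by split; exact: val_inj.
Qed.

Lemma measurable_cylinder (v : seq 'I_k.+1) : measurable (cylinder v).
Proof. by rewrite -[v]/(val (in_tuple v)) -segment_cylinder; exact: measurable_segment. Qed.

End words.

(** * The convolution as a law on pairs of words *)

Section convolution_of_projections.
Context {R : realType} {k1 k2 : nat}.
Variables (a b : R) (t : 'I_k1.+1 -> R) (u : 'I_k2.+1 -> R).
Variables (P1 : probability (words k1) R) (P2 : probability (words k2) R).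

Definition sum_coding (s : R) (w : words k1 * words k2) : R :=
  coding a t w.1 + s * coding b u w.2.

Lemma measurable_sum_coding s : measurable_fun [set: words k1 * words k2] (sum_coding s).
Proof.
apply: measurable_funD.
  exact: measurableT_comp (measurable_coding a t) measurable_fst.
by apply: measurable_funM => //; exact: measurableT_comp (measurable_coding b u) measurable_snd.
Qed.

(** Both measures are pushed forward from words, so the product measure can be
    evaluated on pairs of words, where cylinders are disjoint even if their images
    on the line overlap. *)
Lemma convolution_projectionE s (A : set R) : measurable A ->
  convolution (projection a t P1) (dilate s (projection b u P2)) A =
  (P1 \x P2)%E (sum_coding s @^-1` A).
Proof.
move=> mA.
have mAd : measurable (addpair @^-1` A : set (R * R)).
  rewrite -[X in measurable X]setTI.
  have madd : measurable_fun [set: R * R] (addpair : R * R -> R) by exact: measurable_funD.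
  exact: madd.
transitivity (\int[projection a t P1]_x
    (dilate s (projection b u P2) (xsection (addpair @^-1` A) x)))%E; first by [].
by rewrite ge0_integral_distribution//; exact: measurable_fun_xsection.
Qed.

(** Dilating by 0 gives a point mass at the origin, so results on convolutions
    specialize to a single projection. *)
Lemma convolution_projection0 n q :
  Lq_sum (convolution (projection a t P1) (dilate 0 (projection b u P2))) q n =
  Lq_sum (projection a t P1) q n.
Proof.
rewrite !Lq_sumE; congr fine; apply: eq_esum => j _; congr ((fine _ `^ q)%:E).
rewrite convolution_projectionE; last exact: measurable_cell.
rewrite (_ : _ @^-1` _ = (coding a t @^-1` cell n j) `*` setT).
  have mj : measurable (coding a t @^-1` cell n j).
    by have := measurable_coding a t measurableT (measurable_cell n j); rewrite setTI.
  rewrite product_measure1E// [X in (_ * X)%E](_ : _ = 1%E) ?mule1//.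
  exact: (@probability_setT _ _ _ P2).
by apply/seteqP; split=> -[w w'] /=; rewrite /sum_coding mul0r addr0 //= => -[].
Qed.

End convolution_of_projections.
(** * Estimates for the convolution at all parameters and scales *)

Section scales.
Context {R : realType}.
Implicit Types (x y a : R).

(** Reals at distance at most C lie in cells at most this far apart. *)
Definition floor_gap (C : R) : nat := (Num.trunc C).+1.

Lemma floor_gapP (C x y : R) : `|x - y| <= C ->
  `|Num.floor x - Num.floor y| <= (floor_gap C)%:Z.
Proof.
move=> xy.
have C0 : 0 <= C by exact: le_trans xy.
have /andP[x1 x2] := floor_itv x; have /andP[y1 y2] := floor_itv y.
have tC : C < (Num.trunc C).+1%:R by exact: truncnS_gt.
have : (`|Num.floor x - Num.floor y|%:~R : R) < ((floor_gap C)%:Z + 1)%:~R.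
  move: xy; rewrite intr_norm !intrD rmorphN /floor_gap /= ler_norml ltr_norml.
  move: x2 y2 tC; rewrite !intrD; lra.
by rewrite ltr_int ltzD1.
Qed.

Lemma floor_eq_dist x y : Num.floor x = Num.floor y -> `|x - y| < 1.
Proof.
move=> xy; have /andP[x1 x2] := floor_itv x; have /andP[y1 y2] := floor_itv y.
move: x1 x2 y1 y2; rewrite xy !intrD ltr_norml; lra.
Qed.

Definition int_range (L : nat) : seq int := [seq i%:Z - L%:Z | i <- iota 0 L.*2.+1].

Lemma int_range_uniq L : uniq (int_range L).
Proof. by rewrite map_inj_uniq ?iota_uniq// => i j /addIr []. Qed.

Lemma mem_int_range (z : int) L : `|z| <= L%:Z -> z \in int_range L.
Proof.
move=> zL; apply/mapP; exists (absz (z + L%:Z)%R); last by lia.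
by rewrite mem_iota; lia.
Qed.

(** The first m with a^m at most 2^-n. *)
Lemma level_exists a (n : nat) : 0 < a -> a < 1 ->
  exists m : nat, a <= 2 ^+ n * a ^+ m <= 1.
Proof.
move=> a0 a1.
have p0 : (0 : R) < 2 ^+ n by rewrite exprn_gt0.
have ex : exists m, 2 ^+ n * a ^+ m <= 1.
  have : a ^+ m @[m --> \oo] --> 0 by apply: cvg_expr; rewrite gtr0_norm.
  move=> /cvgrPdist_le /(_ (2 ^- n)); rewrite invr_gt0 => /(_ p0)[N _ hN].
  exists N; have := hN N (leqnn N); rewrite /= sub0r normrN ger0_norm ?exprn_ge0 ?(ltW a0)//.
  by rewrite -ler_pdivlMl// mulr1.
case: (ex_minnP ex) => -[|m] hm mmin.
  by exists 0%N; rewrite hm andbT expr0 mulr1 (le_trans (ltW a1))// exprn_ege1// ler1n.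
exists m.+1; rewrite hm andbT exprS mulrCA ler_peMr ?(ltW a0)//.
by apply: ltW; rewrite ltNge; apply/negP => /mmin; rewrite ltnn.
Qed.

End scales.

Section cylinder_weights.
Context {R : realType} {k : nat}.
Variable P : probability (words k) R.

Definition weight (v : seq 'I_k.+1) : R := fine (P (cylinder v)).

Lemma weight_ge0 v : 0 <= weight v.
Proof. exact: fine_ge0. Qed.

Lemma cylinder_weight v : P (cylinder v) = (weight v)%:E.
Proof. by rewrite fineK// fin_num_measure//; exact: measurable_cylinder. Qed.

Lemma sum_weight m : \sum_(v : m.-tuple 'I_k.+1) weight v = 1.
Proof.
transitivity (\sum_(v : m.-tuple 'I_k.+1) fine (P (segment 0 m @^-1` [set v]))).
  by apply: eq_bigr => v _; rewrite segment_cylinder.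
rewrite (probability_fine_fibres P xpredT); last by move=> v; exact: measurable_segment.
by rewrite (_ : [set w | _] = setT) ?probability_setT//; apply/seteqP.
Qed.

(** The constant in the hypothesis need not be nonnegative a priori. *)
Lemma weight_submul : submultiplicative P ->
  exists2 K : R, 0 <= K & forall v v', weight (v ++ v') <= K * (weight v * weight v').
Proof.
move=> [K hK]; exists (Num.max K 0); first by rewrite le_max lexx orbT.
move=> v v'; have := hK v v'; rewrite !cylinder_weight -!EFinM lee_fin => /le_trans; apply.
by rewrite ler_wpM2r ?le_max ?lexx// mulr_ge0 ?weight_ge0.
Qed.

End cylinder_weights.

Section one_projection.
Context {R : realType} {k : nat}.
Variables (a : R) (t : 'I_k.+1 -> R) (P : probability (words k) R) (q : R).
Hypotheses (a0 : 0 < a) (a1 : a < 1) (q1 : 1 < q).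

Definition word_cell (n m : nat) (v : m.-tuple 'I_k.+1) : int :=
  Num.floor (2 ^+ n * compose_word a t v).

Definition weight_tuple (m : nat) (v : m.-tuple 'I_k.+1) : R := weight P v.

Lemma Lq_sum_projection_approx : exists2 C : R, 0 < C & forall n m,
  2 ^+ n * a ^+ m <= 1 ->
  Lq_sum (projection a t P) q n <= C * fibre_sum q (@weight_tuple m) (@word_cell n m) /\
  fibre_sum q (@weight_tuple m) (@word_cell n m) <= C * Lq_sum (projection a t P) q n.
Proof.
exists (smear_const q (floor_gap (word_bound a t))); first exact: smear_const_gt0.
move=> n m nm.
have mxi (v : m.-tuple 'I_k.+1) : measurable (segment 0 m @^-1` [set v]).
  exact: measurable_segment.
have wE : @weight_tuple m = fun v => fine (P (segment 0 m @^-1` [set v])).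
  by apply/funext => v; rewrite segment_cylinder.
rewrite wE; apply: (@Lq_sum_approx _ _ _ _ _ _ (coding a t)) => //.
move=> w; apply: floor_gapP.
rewrite -mulrBr normrM ger0_norm ?exprn_ge0//.
apply: (@le_trans _ _ (2 ^+ n * (a ^+ m * word_bound a t))).
  by rewrite ler_wpM2l ?exprn_ge0// coding_approx.
by rewrite mulrA ler_piMl// word_bound_ge0.
Qed.

End one_projection.

Section two_projections.
Context {R : realType} {k1 k2 : nat}.
Variables (a b : R) (t : 'I_k1.+1 -> R) (u : 'I_k2.+1 -> R).
Variables (P1 : probability (words k1) R) (P2 : probability (words k2) R).
Variables (q Sg : R).
Hypotheses (a0 : 0 < a) (a1 : a < 1) (b0 : 0 < b) (b1 : b < 1).
Hypotheses (q1 : 1 < q) (Sg0 : 0 <= Sg).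

Definition conv_sum (s : R) (n : nat) : R :=
  Lq_sum (convolution (projection a t P1) (dilate s (projection b u P2))) q n.

Let B1 := word_bound a t.
Let B2 := word_bound b u.
Let B1_ge0 : 0 <= B1. Proof. exact: word_bound_ge0. Qed.
Let B2_ge0 : 0 <= B2. Proof. exact: word_bound_ge0. Qed.
Let Btot : R := B1 + Sg * B2.
Let Btot_ge0 : 0 <= Btot.
Proof. by apply: addr_ge0 => //; exact: mulr_ge0. Qed.

Definition pair_weight (m l : nat) (x : m.-tuple 'I_k1.+1 * l.-tuple 'I_k2.+1) : R :=
  weight_tuple P1 x.1 * weight_tuple P2 x.2.

Definition pair_pos (s : R) (v : seq 'I_k1.+1) (v' : seq 'I_k2.+1) : R :=
  compose_word a t v + s * compose_word b u v'.

Definition pair_cell (s : R) (n m l : nat)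
    (x : m.-tuple 'I_k1.+1 * l.-tuple 'I_k2.+1) : int :=
  Num.floor (2 ^+ n * pair_pos s x.1 x.2).

(** The L^q sum of the finite family obtained by cutting the words after m and l
    letters, at scale 2^-n. *)
Definition pair_sum (s : R) (n m l : nat) : R :=
  fibre_sum q (@pair_weight m l) (@pair_cell s n m l).

Lemma pair_weight_ge0 m l x : 0 <= @pair_weight m l x.
Proof. by rewrite mulr_ge0 ?weight_ge0. Qed.

Lemma sum_pair_weight m l : \sum_x @pair_weight m l x = 1.
Proof.
rewrite -(pair_bigA _ (fun x y => weight_tuple P1 x * weight_tuple P2 y)) /=.
by rewrite -big_distrlr /= !sum_weight mulr1.
Qed.

Lemma pair_pos_bound (s : R) v v' : 0 <= s <= Sg -> `|pair_pos s v v'| <= Btot.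
Proof.
move=> /andP[s0 sS]; apply: (le_trans (ler_normD _ _)).
rewrite normrM ger0_norm// lerD ?compose_word_bound//.
by rewrite ler_pM// compose_word_bound.
Qed.

Lemma conv_sum_approx_gen (X : finType) (xi : words k1 * words k2 -> X)
    (delta : X -> int) (n M : nat) (s : R) :
  (forall x, measurable (xi @^-1` [set x])) ->
  (forall w, `|Num.floor (2 ^+ n * sum_coding a b t u s w) - delta (xi w)| <= M%:Z) ->
  conv_sum s n <= smear_const q M *
    fibre_sum q (fun x => fine ((P1 \x P2)%E (xi @^-1` [set x]))) delta /\
  fibre_sum q (fun x => fine ((P1 \x P2)%E (xi @^-1` [set x]))) delta <=
    smear_const q M * conv_sum s n.
Proof.
move=> mxi close.
apply: (@Lq_sum_approx _ _ _ (P1 \x P2)%E _ _ (sum_coding a b t u s)) => //.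
  exact: measurable_sum_coding.
by move=> A mA; rewrite convolution_projectionE.
Qed.

Lemma sum_coding_close (s : R) n m l w : 0 <= s -> 2 ^+ n * a ^+ m <= 1 ->
  2 ^+ n * (s * b ^+ l) <= Sg ->
  `|2 ^+ n * sum_coding a b t u s w -
    2 ^+ n * pair_pos s (segment 0 m w.1) (segment 0 l w.2)| <= Btot.
Proof.
move=> s0 nm nl.
have p0 : (0 : R) <= 2 ^+ n by rewrite exprn_ge0.
have -> : 2 ^+ n * sum_coding a b t u s w -
    2 ^+ n * pair_pos s (segment 0 m w.1) (segment 0 l w.2) =
  2 ^+ n * (coding a t w.1 - compose_word a t (segment 0 m w.1)) +
  2 ^+ n * s * (coding b u w.2 - compose_word b u (segment 0 l w.2)).
  by rewrite /sum_coding /pair_pos; ring.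
apply: (le_trans (ler_normD _ _)); rewrite !normrM !(ger0_norm p0) (ger0_norm s0).
apply: lerD.
  apply: (@le_trans _ _ (2 ^+ n * (a ^+ m * B1))).
    by rewrite ler_wpM2l// coding_approx.
  by rewrite mulrA ler_piMl.
apply: (@le_trans _ _ (2 ^+ n * s * (b ^+ l * B2))).
  by rewrite ler_wpM2l ?mulr_ge0// coding_approx.
by rewrite mulrA -[_ * s * _]mulrA ler_wpM2r.
Qed.

Lemma conv_sum_approx : exists2 C : R, 0 < C & forall (s : R) n m l, 0 <= s ->
  2 ^+ n * a ^+ m <= 1 -> 2 ^+ n * (s * b ^+ l) <= Sg ->
  conv_sum s n <= C * pair_sum s n m l /\ pair_sum s n m l <= C * conv_sum s n.
Proof.
exists (smear_const q (floor_gap Btot)); first exact: smear_const_gt0.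
move=> s n m l s0 nm nl.
pose xi (w : words k1 * words k2) := (segment 0 m w.1, segment 0 l w.2).
have xiE x : xi @^-1` [set x] = cylinder x.1 `*` cylinder x.2.
  case: x => v v'; rewrite -!segment_cylinder.
  by apply/seteqP; split=> -[w w'] /= => [[<- <-]//|[<- <-]].
have mxi x : measurable (xi @^-1` [set x]).
  by rewrite xiE; apply: measurableX; exact: measurable_cylinder.
have wE : @pair_weight m l = fun x => fine ((P1 \x P2)%E (xi @^-1` [set x])).
  apply/funext => x; rewrite xiE product_measure1E; try exact: measurable_cylinder.
  by rewrite fineM ?fin_num_measure//; exact: measurable_cylinder.
rewrite /pair_sum wE; apply: conv_sum_approx_gen => // w.
by apply: floor_gapP; exact: sum_coding_close.
Qed.

Lemma conv_level (s : R) n : 0 <= s <= Sg -> exists m l : nat,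
  2 ^+ n * a ^+ m <= 1 /\ 2 ^+ n * (s * b ^+ l) <= Sg.
Proof.
move=> /andP[s0 sS].
have [m /andP[_ hm]] := level_exists n a0 a1.
have [l /andP[_ hl]] := level_exists n b0 b1.
exists m, l; split=> //; rewrite mulrCA -[leRHS]mulr1 ler_pM//.
by rewrite mulr_ge0// exprn_ge0// ltW.
Qed.

Lemma conv_sum_upper : exists2 C : R, 0 < C & forall (s : R) n, 0 <= s <= Sg ->
  conv_sum s n <= C.
Proof.
have [C C0 hC] := conv_sum_approx; exists C => // s n sS.
have [m [l [nm nl]]] := conv_level n sS.
have [h _] := hC s n m l (proj1 (andP sS)) nm nl.
apply: (le_trans h); rewrite ler_piMr ?(ltW C0)//.
by apply: fibre_sum_le1 => //; [exact: pair_weight_ge0|exact: sum_pair_weight].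
Qed.

(** The support is bounded, hence meets O(2^n) cells. *)
Lemma conv_sum_lower : exists2 c : R, 0 < c & forall (s : R) n, 0 <= s <= Sg ->
  c * (2 ^+ n) `^ (1 - q) <= conv_sum s n.
Proof.
have [C C0 hC] := conv_sum_approx.
pose D : R := 2 * Btot + 3.
have D0 : 0 < D by rewrite /D; move: Btot_ge0; lra.
exists (C^-1 * D `^ (1 - q)); first by rewrite mulr_gt0 ?invr_gt0 ?powR_gt0.
move=> s n sS; have [m [l [nm nl]]] := conv_level n sS.
have [_ h] := hC s n m l (proj1 (andP sS)) nm nl.
rewrite -mulrA ler_pdivrMl//; apply: le_trans h.
pose L := (Num.trunc (2 ^+ n * Btot)).+1.
pose r := int_range L.
have p1 : (1 : R) <= 2 ^+ n by rewrite exprn_ege1// ler1n.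
apply: (@le_trans _ _ ((size r)%:R `^ (1 - q))).
  rewrite -powRM ?exprn_ge0 ?(ltW D0)// size_map size_iota.
  rewrite -opprB !powRN lef_pV2 ?posrE ?powR_gt0 ?mulr_gt0 ?exprn_gt0//.
  apply: le_powR; [by rewrite subr_ge0 ltW|exact: ler0n|].
  have : (Num.trunc (2 ^+ n * Btot))%:R <= 2 ^+ n * Btot.
    by rewrite truncn_le// mulr_ge0// exprn_ge0.
  have -> : (L.*2.+1)%:R = 2 * ((Num.trunc (2 ^+ n * Btot))%:R + 1) + 1 :> R.
    by rewrite natr1 -natrM natr1 mul2n.
  rewrite /D.
  set T := (Num.trunc _)%:R; set p := 2 ^+ n in p1 *; set B := Btot; lra.
apply: (fibre_sum_ge_card q1) => //.
- exact: pair_weight_ge0.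
- exact: sum_pair_weight.
- exact: int_range_uniq.
move=> x; apply: mem_int_range; rewrite -[X in `|X|]subr0 -(@floor0 R).
apply: floor_gapP; rewrite subr0 normrM ger0_norm ?exprn_ge0//.
by rewrite ler_wpM2l ?exprn_ge0//; exact: pair_pos_bound.
Qed.

Lemma conv_sum_gt0 (s : R) n : 0 <= s <= Sg -> 0 < conv_sum s n.
Proof.
move=> sS; have [c c0 hc] := conv_sum_lower.
by apply: lt_le_trans (hc s n sS); rewrite mulr_gt0 ?powR_gt0 ?exprn_gt0.
Qed.

(** The cell of x + s y is determined, up to a bounded error, by the cells of x
    and y; coarser partitions have larger sums. *)
Lemma conv_sum_ge_product : exists2 c : R, 0 < c & forall (s : R) n, 0 <= s <= Sg ->
  c * (Lq_sum (projection a t P1) q n * Lq_sum (projection b u P2) q n) <= conv_sum s n.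
Proof.
have [C C0 hC] := conv_sum_approx.
have [C1 C10 hC1] := Lq_sum_projection_approx t P1 a0 a1 q1.
have [C2 C20 hC2] := Lq_sum_projection_approx u P2 b0 b1 q1.
pose S := smear_const q (floor_gap (1 + Sg)).
have S0 : 0 < S by exact: smear_const_gt0.
exists ((C * S * (C1 * C2))^-1); first by rewrite invr_gt0 !mulr_gt0.
move=> s n /andP[s0 sS].
have [m /andP[_ nm]] := level_exists n a0 a1.
have [l /andP[_ nl]] := level_exists n b0 b1.
have nl' : 2 ^+ n * (s * b ^+ l) <= Sg.
  by rewrite mulrCA -[leRHS]mulr1 ler_pM// mulr_ge0// exprn_ge0// ltW.
have [_ h] := hC s n m l s0 nm nl'.
have [h1 _] := hC1 n m nm; have [h2 _] := hC2 n l nl.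
have E1 := fibre_sum_ge0 q (@word_cell R k1 a t n m) (fun v => weight_ge0 P1 v).
have E2 := fibre_sum_ge0 q (@word_cell R k2 b u n l) (fun v => weight_ge0 P2 v).
rewrite ler_pdivrMl ?mulr_gt0//.
apply: (@le_trans _ _ (C1 * C2 * (fibre_sum q (@weight_tuple R k1 P1 m) (@word_cell R k1 a t n m) *
  fibre_sum q (@weight_tuple R k2 P2 l) (@word_cell R k2 b u n l)))).
  rewrite mulrACA; apply: ler_pM => //;
    by apply: fine_ge0; apply: esum_ge0 => i _; exact: poweR_ge0.
rewrite [leRHS](_ : _ = C1 * C2 * (S * (C * conv_sum s n))); last by ring.
rewrite ler_wpM2l ?mulr_ge0 ?(ltW C10) ?(ltW C20)//.
apply: (@le_trans _ _ (S * pair_sum s n m l)); last by rewrite ler_wpM2l ?(ltW S0).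
rewrite -fibre_sum_product; try by move=> v; exact: weight_ge0.
apply: fibre_sum_compare => //; first exact: pair_weight_ge0.
move=> x y [] /floor_eq_dist hx /floor_eq_dist hy; apply: floor_gapP.
rewrite (_ : _ - _ = (2 ^+ n * compose_word a t x.1 - 2 ^+ n * compose_word a t y.1) +
  s * (2 ^+ n * compose_word b u x.2 - 2 ^+ n * compose_word b u y.2)); last first.
  by rewrite /pair_pos; ring.
apply: (le_trans (ler_normD _ _)); apply: lerD; first exact: ltW.
by rewrite normrM ger0_norm// -[leRHS]mulr1 ler_pM// ltW.
Qed.

Hypotheses (P1_sub : submultiplicative P1) (P2_sub : submultiplicative P2).

(** Split pairs of words into prefixes of lengths (m, l) and remainders.  The
    point of a concatenation is z + a^m z', where z belongs to the dilation s and
    z' to the dilation s': the second coordinate of z' carries the factor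
    s b^l = s' a^m.  Rescaling by a^m turns scale 2^-(n+n') into 2^-n' up to a
    bounded factor, so fibre_sum_submul applies. *)
Lemma conv_sum_cocycle : exists2 C : R, 0 < C & forall n n' m l (s s' : R),
  0 <= s <= Sg -> 0 <= s' <= Sg -> a <= 2 ^+ n * a ^+ m <= 1 ->
  s * b ^+ l = s' * a ^+ m ->
  conv_sum s (n + n') <= C * (conv_sum s n * conv_sum s' n').
Proof.
have [C C0 hC] := conv_sum_approx.
have [K1 K10 hK1] := weight_submul P1_sub.
have [K2 K20 hK2] := weight_submul P2_sub.
pose K := K1 * K2 + 1.
have K0 : 0 < K by rewrite ltr_wpDl// mulr_ge0.
pose S0 := smear_const q (floor_gap Btot).
pose S1 := smear_const q (floor_gap (1 + 2 * Btot)).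
pose S2 := smear_const q (floor_gap a^-1).
have S00 : 0 < S0 by exact: smear_const_gt0.
have S10 : 0 < S1 by exact: smear_const_gt0.
have S20 : 0 < S2 by exact: smear_const_gt0.
exists (S0 * (K `^ q * S1 * S2) * (C * C)); first by rewrite !mulr_gt0 ?powR_gt0.
move=> n n' m l s s' sS s'S /andP[nm_ge nm_le] ss'.
have /andP[s0 sSg] := sS; have /andP[s'0 s'Sg] := s'S.
have pn : (0 : R) < 2 ^+ n by rewrite exprn_gt0.
have pn' : (0 : R) < 2 ^+ n' by rewrite exprn_gt0.
have pam : 0 < a ^+ m by rewrite exprn_gt0.
have [m' /andP[_ nm']] := level_exists n' a0 a1.
have [l' /andP[_ nl']] := level_exists n' b0 b1.
have nl'' : 2 ^+ n' * (s' * b ^+ l') <= Sg.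
  by rewrite mulrCA -[leRHS]mulr1 ler_pM// mulr_ge0 ?exprn_ge0 ?(ltW b0).
have nl : 2 ^+ n * (s * b ^+ l) <= Sg.
  by rewrite ss' mulrCA -[leRHS]mulr1 ler_pM// mulr_ge0 ?exprn_ge0 ?(ltW a0).
have [_ hn] := hC s n m l s0 nm_le nl.
have [_ hn'] := hC s' n' m' l' s'0 nm' nl''.
pose X := (m.-tuple 'I_k1.+1 * l.-tuple 'I_k2.+1)%type.
pose X' := (m'.-tuple 'I_k1.+1 * l'.-tuple 'I_k2.+1)%type.
pose xi (w : words k1 * words k2) : X * X' :=
  ((segment 0 m w.1, segment 0 l w.2), (segment m m' w.1, segment l l' w.2)).
pose delta (x : X * X') : int := Num.floor (2 ^+ (n + n') *
  (pair_pos s x.1.1 x.1.2 + a ^+ m * pair_pos s' x.2.1 x.2.2)).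
have xiE x : xi @^-1` [set x] = cylinder (x.1.1 ++ x.2.1) `*` cylinder (x.1.2 ++ x.2.2).
  case: x => -[v1 v2] [v1' v2'] /=; rewrite -!segment2_cylinder.
  apply/seteqP; split=> -[w w'] /=; first by move=> [<- <- <- <-].
  by move=> [[<- <-] [<- <-]].
have mxi x : measurable (xi @^-1` [set x]).
  by rewrite xiE; apply: measurableX; exact: measurable_cylinder.
have wE x : fine ((P1 \x P2)%E (xi @^-1` [set x])) =
    weight P1 (x.1.1 ++ x.2.1) * weight P2 (x.1.2 ++ x.2.2).
  rewrite xiE product_measure1E; try exact: measurable_cylinder.
  by rewrite fineM ?fin_num_measure//; exact: measurable_cylinder.
have w0 x : 0 <= fine ((P1 \x P2)%E (xi @^-1` [set x])).
  by rewrite wE mulr_ge0 ?weight_ge0.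
have [hE _] : conv_sum s (n + n') <= S0 *
    fibre_sum q (fun x => fine ((P1 \x P2)%E (xi @^-1` [set x]))) delta /\
  fibre_sum q (fun x => fine ((P1 \x P2)%E (xi @^-1` [set x]))) delta <=
    S0 * conv_sum s (n + n').
  apply: conv_sum_approx_gen => // w; apply: floor_gapP.
  rewrite (_ : pair_pos s (xi w).1.1 (xi w).1.2 + _ =
     pair_pos s (segment 0 (m + m') w.1) (segment 0 (l + l') w.2)).
    apply: sum_coding_close => //.
      by rewrite !exprD mulrACA -[leRHS]mulr1; apply: ler_pM => //;
        rewrite mulr_ge0 ?exprn_ge0 ?(ltW a0).
    have -> : 2 ^+ (n + n') * (s * b ^+ (l + l')) =
        (2 ^+ n * a ^+ m) * (2 ^+ n' * (s' * b ^+ l')).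
      by rewrite !exprD (mulrA s) ss'; ring.
    rewrite -[leRHS]mul1r; apply: ler_pM => //; first by rewrite mulr_ge0 ?ltW.
    by rewrite !mulr_ge0 ?exprn_ge0 ?(ltW b0).
  rewrite /pair_pos !segment_cat !compose_word_cat /= !size_mkseq.
  by rewrite [in RHS]mulrDr [in RHS]mulrA ss'; ring.
rewrite -!mulrA in hE *; apply: (le_trans hE); rewrite ler_wpM2l ?(ltW S00)//.
apply: (@le_trans _ _ (K `^ q * S1 * S2 * (pair_sum s n m l * pair_sum s' n' m' l'))).
  apply: fibre_sum_submul => //; [exact: ltW|exact: pair_weight_ge0|
    exact: pair_weight_ge0| | |].
  - move=> [v1 v2] [v1' v2']; rewrite wE /=.
    apply: (@le_trans _ _ ((K1 * K2) * (pair_weight (v1, v2) * pair_weight (v1', v2')))).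
      rewrite /pair_weight /=.
      rewrite (_ : _ * _ * _ = K1 * (weight P1 v1 * weight P1 v1') *
         (K2 * (weight P2 v2 * weight P2 v2'))); last by rewrite /weight_tuple; ring.
      by rewrite ler_pM ?weight_ge0.
    apply: ler_wpM2r; first by rewrite mulr_ge0 ?pair_weight_ge0.
    by rewrite /K lerDl.
  - move=> [v1 v2] [v1' v2'] [y1 y2] [y1' y2'] /floor_eq_dist; rewrite /= exprD => h.
    apply: floor_gapP => /=.
    have hb := pair_pos_bound v1' v2' s'S; have hb' := pair_pos_bound y1' y2' s'S.
    set p := pair_pos s v1 v2 in h *; set p1 := pair_pos s y1 y2 in h *.
    set r := pair_pos s' v1' v2' in h hb *; set r1 := pair_pos s' y1' y2' in h hb' *.
    have h1 : `|2 ^+ n * (p - p1) + 2 ^+ n * a ^+ m * (r - r1)| <= 1.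
      apply: le_trans (ltW h).
      rewrite [X in _ <= `|X|](_ : _ = 2 ^+ n' * (2 ^+ n * (p - p1) + 2 ^+ n * a ^+ m * (r - r1))).
        rewrite normrM (gtr0_norm pn') ler_peMl//.
        by rewrite exprn_ege1// ler1n.
      by ring.
    have h2 : `|2 ^+ n * a ^+ m * (r - r1)| <= 2 * Btot.
      rewrite normrM ger0_norm; last by rewrite mulr_ge0// ltW.
      rewrite -[leRHS]mul1r ler_pM ?mulr_ge0 ?(ltW pn) ?(ltW pam)//.
      by rewrite (le_trans (ler_normB _ _))// mulrDl mul1r lerD.
    rewrite -mulrBr.
    move: h1 h2; rewrite !ler_norml; lra.
  - move=> [v1 v2] [v1' v2'] [y1' y2'] /floor_eq_dist; rewrite /= exprD => h.
    apply: floor_gapP => /=; rewrite -mulrBr.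
    move: h.
    rewrite (_ : _ - _ = (2 ^+ n * a ^+ m) *
       (2 ^+ n' * (pair_pos s' v1' v2' - pair_pos s' y1' y2'))); last by ring.
    rewrite normrM ger0_norm; last by rewrite mulr_ge0// ltW.
    set z := `| _ | => h.
    rewrite -[leRHS]mulr1 ler_pdivlMl//; apply: le_trans (ltW h).
    by rewrite ler_wpM2r// /z normr_ge0.
rewrite -!mulrA !ler_wpM2l ?(ltW S10) ?(ltW S20) ?powR_ge0//.
rewrite (_ : C * _ = C * conv_sum s n * (C * conv_sum s' n')); last by ring.
by rewrite ler_pM ?fibre_sum_ge0//; exact: pair_weight_ge0.
Qed.

End two_projections.
(** * A discrete projection theorem *)

Section counting.
Context {R : realType}.

(** Jensen's inequality for the concave function x |-> x^r, obtained from
    powR_Jensen with the exponent 1/r. *)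
Lemma powR_sum_concave (P : nat) (y : nat -> R) (r : R) : 0 < r -> r <= 1 ->
  (forall l, 0 <= y l) -> (0 < P)%N ->
  \sum_(l < P) y l `^ r <= P%:R * ((\sum_(l < P) y l) / P%:R) `^ r.
Proof.
move=> r0 r1 y0 P0.
have PR : (0 : R) < P%:R by rewrite ltr0n.
have S0 : 0 <= \sum_(l < P) y l by apply: sumr_ge0.
move: r1; rewrite le_eqVlt => /predU1P[->|r1].
  rewrite powRr1 ?divr_ge0 ?(ltW PR)// mulrCA divff ?gt_eqF// mulr1.
  by apply: ler_sum => l _; rewrite powRr1.
have rV : 1 < r^-1 by rewrite invf_gt1.
have W1 : \sum_(l < P) (P%:R^-1 : R) = 1.
  by rewrite sumr_const card_ord -[_ *+ _]mulr_natr mulVf ?gt_eqF.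
have := @powR_Jensen _ _ (index_enum 'I_P) xpredT (fun=> P%:R^-1) (fun l => y l `^ r) _ rV.
have PV0 : (0 : R) <= P%:R^-1 by rewrite invr_ge0 ltW.
rewrite W1 powR1 mul1r -!mulr_sumr => /(_ (fun _ _ => PV0) (fun _ _ => powR_ge0 _ _)).
have -> : \sum_(l < P) (y l `^ r) `^ r^-1 = \sum_(l < P) y l.
  by apply: eq_bigr => l _; rewrite -powRrM mulfV ?gt_eqF// powRr1.
set T := \sum_(l < P) _ => h.
have T0 : 0 <= P%:R^-1 * T.
  by rewrite mulr_ge0 ?invr_ge0 ?(ltW PR)// sumr_ge0// => l _; exact: powR_ge0.
have := le_powR (ltW r0) (powR_ge0 _ _) h.
rewrite -powRrM mulVf ?gt_eqF// powRr1// ler_pdivrMl// => h'.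
by rewrite [_ / _]mulrC.
Qed.

(** The points i g with i in Q are g-separated and lie in an interval of length
    tau. *)
Lemma card_separated (P : nat) (Q : pred 'I_P) (g tau : R) : 0 < g -> 0 <= tau ->
  (forall i j : 'I_P, Q i -> Q j -> `|i%:R - j%:R| * g <= tau) ->
  #|Q|%:R <= 1 + tau / g.
Proof.
move=> g0 tau0 sep.
have tg0 : 0 <= tau / g by rewrite divr_ge0// ltW.
have [i1 Qi1|Q0] := pickP Q; last first.
  by rewrite eq_card0 ?addr_ge0// => i; exact: Q0.
pose i0 := [arg min_(i < i1 | Q i) (i : nat)].
have [Qi0 i0min] : Q i0 /\ forall j, Q j -> (i0 <= j)%N.
  by rewrite /i0; case: arg_minnP.
pose K := Num.trunc (tau / g).
have range j : Q j -> (j - i0 <= K)%N.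
  move=> Qj; rewrite -(ler_nat R) natrB ?i0min//.
  have : (j%:R - i0%:R : R) <= tau / g.
    by rewrite ler_pdivlMr// (le_trans _ (sep j i0 Qj Qi0))// ler_wpM2r ?(ltW g0)// ler_norm.
  rewrite -natrB ?i0min// => h; rewrite ler_nat.
  by rewrite /K truncn_ge_nat.
pose f (j : 'I_P) : 'I_K.+1 := inord (j - i0).
have finj : {in Q &, injective f}.
  move=> i j Qi Qj /(congr1 val); rewrite /= !inordK ?ltnS ?range// => h.
  by apply: val_inj => /=; have := i0min i Qi; have := i0min j Qj; move: h; clear; lia.
apply: (@le_trans _ _ K.+1%:R).
  by rewrite ler_nat -[leqRHS]card_ord; exact: leq_card_in finj.
by rewrite -natr1 addrC lerD2l truncn_le.
Qed.

End counting.

Section marstrand.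
Context {R : realType}.

(** The transversality behind the projection theorem.  If |(dx, dy)| is about
    2^(j-n), the parameters s with |dx + s dy| <= 2^-n form an interval of length
    about 2^-j, and a fraction about 2^-j of the g-separated points s i falls
    there.  The least j for which both coordinates are below B 2^(j-n) is the
    witness. *)
Lemma separated_crossings_le (P n : nat) (s : nat -> R) (g c0 Sg B dx dy : R) (Q : pred 'I_P) :
  0 <= Sg -> 0 < c0 -> 0 < g -> g <= 2 ^- n -> c0 <= P%:R * g -> 2 <= B ->
  (forall l : 'I_P, 0 <= s l <= Sg) ->
  (forall i j : 'I_P, `|i%:R - j%:R| * g <= `|s i - s j|) ->
  `|dx| <= B -> `|dy| <= B ->
  (forall l, Q l -> `|dx + s l * dy| <= 2 ^- n) ->
  exists j : 'I_n.+1, [/\ `|dx| <= B * (2 ^+ j * 2 ^- n), `|dy| <= B * (2 ^+ j * 2 ^- n) &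
    #|Q|%:R <= P%:R * (1 + (4 * Sg + 5) / c0) * 2 ^- j].
Proof.
move=> S0 c00 g0 gn Pg B2 sS sep dxB dyB hit.
have pn : (0 : R) < 2 ^- n by rewrite invr_gt0 exprn_gt0.
have P0 : (0 : R) <= P%:R by exact: ler0n.
pose close j := (`|dx| <= B * (2 ^+ j * 2 ^- n)) && (`|dy| <= B * (2 ^+ j * 2 ^- n)).
have closen : close n.
  by rewrite /close divff ?mulr1 ?dxB// gt_eqF// exprn_gt0.
have ex : exists j, close j by exists n.
case: (ex_minnP ex) => j /andP[jx jy] jmin.
have jn : (j < n.+1)%N by rewrite ltnS jmin.
exists (Ordinal jn) => /=; split => //.
have [Q0|[l1 Ql1]] : #|Q| = 0%N \/ exists l1, Q l1.
  by have [l1 Ql1|Q0] := pickP Q; [right; exists l1|left; rewrite eq_card0].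
  rewrite Q0 mulr_ge0 ?invr_ge0 ?exprn_ge0// mulr_ge0// addr_ge0// divr_ge0 ?(ltW c00)//.
  by rewrite addr_ge0 ?mulr_ge0.
have /andP[s10 s1S] := sS l1.
have QP : #|Q|%:R <= P%:R :> R by rewrite ler_nat -[leqRHS]card_ord max_card.
case: j jx jy jmin jn => [|j] jx jy jmin jn.
  rewrite expr0 invr1 mulr1; apply: (le_trans QP).
  by rewrite ler_peMr// lerDl divr_ge0 ?(ltW c00)// addr_ge0 ?mulr_ge0.
have pj : (0 : R) < 2 ^+ j by rewrite exprn_gt0.
have pj1 : (1 : R) <= 2 ^+ j by rewrite exprn_ege1// ler1n.
pose e : R := 2 ^+ j * 2 ^- n.
have e0 : 0 < e by rewrite mulr_gt0.
have en : 2 ^- n <= e by rewrite ler_peMl// ltW.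
(* By minimality of j one coordinate exceeds B e; a crossing forces dx to be
   comparable to dy, so dy cannot be small. *)
have dy_ge : e <= (Sg + 1) * `|dy|.
  rewrite leNgt; apply/negP => dy_lt.
  have /negP : ~~ close j by apply/negP => /jmin; rewrite ltnn.
  apply; rewrite /close -/e; apply/andP; split; last first.
    have := normr_ge0 dy; nra.
  have h1 := hit l1 Ql1.
  have h2 : `|dx| <= `|dx + s l1 * dy| + s l1 * `|dy|.
    rewrite -{2}(ger0_norm s10) -normrM; apply: le_trans (ler_normB _ _).
    by rewrite addrK.
  have h3 : s l1 * `|dy| <= Sg * `|dy| by rewrite ler_wpM2r.
  have := normr_ge0 dy; nra.
pose tau : R := 4 * (Sg + 1) * 2 ^- j.+1.
have tau0 : 0 <= tau by rewrite !mulr_ge0 ?addr_ge0 ?invr_ge0 ?exprn_ge0.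
have taue : tau * e = 2 * (Sg + 1) * 2 ^- n.
  rewrite /tau /e exprS; field.
  by rewrite !gt_eqF// exprn_gt0.
have cardQ : #|Q|%:R <= 1 + tau / g.
  apply: card_separated => // i i' Qi Qi'; apply: (le_trans (sep i i')).
  have h : `|s i - s i'| * `|dy| <= 2 * 2 ^- n.
    rewrite -normrM.
    have -> : (s i - s i') * dy = (dx + s i * dy) - (dx + s i' * dy) by ring.
    by rewrite (le_trans (ler_normB _ _))// mulr_natl mulr2n lerD ?hit.
  rewrite -(ler_pM2r e0) taue.
  apply: (@le_trans _ _ (`|s i - s i'| * ((Sg + 1) * `|dy|))).
    by rewrite ler_wpM2l.
  rewrite [leLHS](_ : _ = `|s i - s i'| * `|dy| * (Sg + 1)); last by ring.
  rewrite [leRHS](_ : _ = 2 * 2 ^- n * (Sg + 1)); last by ring.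
  by rewrite ler_wpM2r ?addr_ge0.
apply: (le_trans cardQ).
have g_j : g <= 2 ^- j.+1.
  apply: (le_trans gn); rewrite lef_pV2 ?posrE ?exprn_gt0// ler_weXn2l ?ler1n//.
set d := 2 ^- j.+1 in tau tau0 taue cardQ g_j *.
have d0 : 0 < d by exact: lt_le_trans g_j.
apply: (@le_trans _ _ ((4 * Sg + 5) * d / g)).
  rewrite -[X in X + _](divff (lt0r_neq0 g0)) -mulrDl ler_wpM2r ?invr_ge0 ?(ltW g0)//.
  rewrite /tau; lra.
apply: (@le_trans _ _ ((4 * Sg + 5) * d * (P%:R / c0))).
  apply: ler_wpM2l; first by rewrite mulr_ge0 ?(ltW d0)// addr_ge0 ?mulr_ge0.
  by rewrite ler_pdivlMr// mulrC ler_pdivrMr.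
rewrite [leLHS](_ : _ = P%:R * ((4 * Sg + 5) / c0) * d); last by ring.
by rewrite ler_wpM2r ?(ltW d0)// ler_wpM2l// lerDr.
Qed.


Context {k1 k2 : nat}.
Variables (a b : R) (t : 'I_k1.+1 -> R) (u : 'I_k2.+1 -> R).
Variables (P1 : probability (words k1) R) (P2 : probability (words k2) R).
Variables (q Sg c0 : R).
Hypotheses (a0 : 0 < a) (a1 : a < 1) (b0 : 0 < b) (b1 : b < 1).
Hypotheses (q1 : 1 < q) (q2 : q <= 2) (Sg0 : 0 <= Sg) (c00 : 0 < c0).

Let B : R := 2 * (word_bound a t + word_bound b u) + 2.
Let M := floor_gap B.
Let C1 : R := 1 + (4 * Sg + 5) / c0.

Let wB1 : 0 <= word_bound a t. Proof. exact: word_bound_ge0. Qed.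
Let wB2 : 0 <= word_bound b u. Proof. exact: word_bound_ge0. Qed.
Let th0 : 0 < q - 1. Proof. by rewrite subr_gt0. Qed.
Let th1 : q - 1 <= 1. Proof. by move: q2; lra. Qed.
Let C10 : 0 < C1.
Proof. by rewrite ltr_wpDr// divr_ge0 ?(ltW c00)// addr_ge0 ?mulr_ge0. Qed.

(** The mass of a square about x with side comparable to 2^(j-n). *)
Definition ball2_mass (n m l j : nat) (x : m.-tuple 'I_k1.+1 * l.-tuple 'I_k2.+1) : R :=
  ball_mass (@weight_tuple R k1 P1 m) (@word_cell R k1 a t (n - j) m) M x.1 *
  ball_mass (@weight_tuple R k2 P2 l) (@word_cell R k2 b u (n - j) l) M x.2.

Let ball2_mass_ge0 n m l j x : 0 <= @ball2_mass n m l j x.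
Proof. by rewrite mulr_ge0// ball_mass_ge0// => v; exact: weight_ge0. Qed.

Lemma compose_word_dist (k : nat) (c : R) (r : 'I_k.+1 -> R) (v v' : seq 'I_k.+1) :
  0 < c -> c < 1 ->
  `|compose_word c r v - compose_word c r v'| <= 2 * word_bound c r.
Proof.
move=> c_gt0 c_lt1; apply: (le_trans (ler_normB _ _)).
by rewrite mulr_natl mulr2n lerD// compose_word_bound.
Qed.

Lemma word_cell_close (k : nat) (c : R) (r : 'I_k.+1 -> R) (n m j : nat)
    (v v' : m.-tuple 'I_k.+1) : (j <= n)%N ->
  `|compose_word c r v - compose_word c r v'| <= B * (2 ^+ j * 2 ^- n) ->
  `|word_cell c r (n - j) v - word_cell c r (n - j) v'| <= M%:Z.
Proof.
move=> jn h; apply: floor_gapP; rewrite -mulrBr normrM ger0_norm ?exprn_ge0//.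
have pj : (0 : R) < 2 ^+ j * 2 ^- n by rewrite mulr_gt0 ?invr_gt0 ?exprn_gt0.
rewrite -(ler_pM2r pj) (le_trans _ h)//.
rewrite mulrAC (_ : 2 ^+ (n - j) * _ = 1) ?mul1r//.
by rewrite mulrA -exprD subnK// divff// gt_eqF// exprn_gt0.
Qed.

(** Exchanging sums, the left side is the sum over y of the weight of y times the
    number of parameters for which x and y project to the same cell. *)
Lemma sum_fibre_mass_le (P n m l : nat) (s : nat -> R) (g : R)
    (x : m.-tuple 'I_k1.+1 * l.-tuple 'I_k2.+1) :
  0 < g -> g <= 2 ^- n -> c0 <= P%:R * g ->
  (forall i : 'I_P, 0 <= s i <= Sg) ->
  (forall i j : 'I_P, `|i%:R - j%:R| * g <= `|s i - s j|) ->
  \sum_(i < P) fibre_mass (@pair_weight R k1 k2 P1 P2 m l)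
      (@pair_cell R k1 k2 a b t u (s i) n m l) (pair_cell a b t u (s i) n x) <=
  P%:R * C1 * \sum_(j < n.+1) 2 ^- j * ball2_mass n j x.
Proof.
move=> g0 gn Pg sS sep.
pose w := @pair_weight R k1 k2 P1 P2 m l.
have w0 y : 0 <= w y by exact: pair_weight_ge0.
pose near j (y : m.-tuple 'I_k1.+1 * l.-tuple 'I_k2.+1) : bool :=
  (`|word_cell a t (n - j) y.1 - word_cell a t (n - j) x.1| <= M%:Z) &&
  (`|word_cell b u (n - j) y.2 - word_cell b u (n - j) x.2| <= M%:Z).
have massE j : ball2_mass n j x = \sum_(y | near j y) w y.
  by rewrite /ball2_mass /ball_mass big_distrlr /= pair_big.
pose Q (y : m.-tuple 'I_k1.+1 * l.-tuple 'I_k2.+1) :=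
  [pred i : 'I_P | pair_cell a b t u (s i) n y == pair_cell a b t u (s i) n x].
have -> : \sum_(i < P) fibre_mass w (@pair_cell R k1 k2 a b t u (s i) n m l)
    (pair_cell a b t u (s i) n x) = \sum_y w y * #|Q y|%:R.
  rewrite /fibre_mass; under eq_bigr do rewrite big_mkcond /=.
  rewrite exchange_big /=; apply: eq_bigr => y _.
  by rewrite -big_mkcond /= sumr_const mulr_natr.
under [in leRHS]eq_bigr do rewrite massE big_mkcond mulr_sumr /=.
rewrite exchange_big mulr_sumr /=; apply: ler_sum => y _.
have B2 : 2 <= B by rewrite /B; move: wB1 wB2; lra.
have dxB : `|compose_word a t y.1 - compose_word a t x.1| <= B.
  by apply: (le_trans (compose_word_dist _ _ _ a0 a1)); rewrite /B; move: wB1 wB2; lra.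
have dyB : `|compose_word b u y.2 - compose_word b u x.2| <= B.
  by apply: (le_trans (compose_word_dist _ _ _ b0 b1)); rewrite /B; move: wB1 wB2; lra.
have hit i : Q y i -> `|(compose_word a t y.1 - compose_word a t x.1) +
    s i * (compose_word b u y.2 - compose_word b u x.2)| <= 2 ^- n.
  move=> /eqP /floor_eq_dist; rewrite -mulrBr normrM ger0_norm ?exprn_ge0//.
  rewrite -ltr_pdivlMl ?exprn_gt0// mulr1 => /ltW; rewrite /pair_pos.
  by congr (`| _ | <= _); ring.
have [j [jx jy jQ]] := separated_crossings_le Sg0 c00 g0 gn Pg B2 sS sep dxB dyB hit.
have jn : (j <= n)%N by rewrite -ltnS.
have nearj : near j y by rewrite /near !word_cell_close.
rewrite mulrC (bigD1 j)//= nearj.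
apply: (@le_trans _ _ (P%:R * C1 * 2 ^- j * w y)); first by rewrite ler_wpM2r.
rewrite -!mulrA ler_wpM2l// ler_wpM2l ?(ltW C10)// lerDl.
apply: sumr_ge0 => i _; rewrite mulr_ge0 ?invr_ge0 ?exprn_ge0//.
by case: ifP.
Qed.

(** Write the q-th powers as masses times (q-1)-th powers of masses.  As
    q - 1 <= 1, the mean over the parameters enters the (q-1)-th power by
    concavity; sum_fibre_mass_le bounds the result by masses of squares of side
    2^(j-n) weighted by 2^-j, and these masses are products, so that summing over
    the points gives the L^q sums of the two factors at scale 2^(j-n). *)
Lemma conv_sum_mean : exists2 C : R, 0 < C & forall (n P : nat) (s : nat -> R) (g : R),
  (0 < P)%N -> 0 < g -> g <= 2 ^- n -> c0 <= P%:R * g ->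
  (forall i : 'I_P, 0 <= s i <= Sg) ->
  (forall i j : 'I_P, `|i%:R - j%:R| * g <= `|s i - s j|) ->
  \sum_(i < P) conv_sum a b t u P1 P2 q (s i) n <=
  C * (P%:R * n.+1%:R * \sum_(j < n.+1) (2 ^- j) `^ (q - 1) *
    (Lq_sum (projection a t P1) q (n - j) * Lq_sum (projection b u P2) q (n - j))).
Proof.
have [C C_gt0 hC] := conv_sum_approx t u P1 P2 Sg a0 a1 b0 b1 q1.
have [D1 D10 hD1] := Lq_sum_projection_approx t P1 a0 a1 q1.
have [D2 D20 hD2] := Lq_sum_projection_approx u P2 b0 b1 q1.
pose S := smear_const q M.
have S0 : 0 < S by exact: smear_const_gt0.
exists (C * C1 `^ (q - 1) * (S * S * (D1 * D2))).
  by rewrite !mulr_gt0 ?powR_gt0.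
move=> n P s g P_gt0 g0 gn Pg sS sep.
have [m /andP[_ nm]] := level_exists n a0 a1.
have [l /andP[_ nl]] := level_exists n b0 b1.
have PR : (0 : R) < P%:R by rewrite ltr0n.
pose w := @pair_weight R k1 k2 P1 P2 m l.
have w0 y : 0 <= w y by exact: pair_weight_ge0.
pose c i := @pair_cell R k1 k2 a b t u (s i) n m l.
apply: (@le_trans _ _ (\sum_(i < P) C * fibre_sum q w (c i))).
  apply: ler_sum => i _; have /andP[si0 siS] := sS i.
  have nl' : 2 ^+ n * (s i * b ^+ l) <= Sg.
    by rewrite mulrCA -[leRHS]mulr1 ler_pM// mulr_ge0// exprn_ge0// ltW.
  exact: (hC (s i) n m l si0 nm nl').1.
rewrite -mulr_sumr -!mulrA ler_wpM2l ?(ltW C_gt0)//.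
apply: (@le_trans _ _ (\sum_x w x * (P%:R * (C1 `^ (q - 1) * (n.+1%:R *
   \sum_(j < n.+1) (2 ^- j) `^ (q - 1) * ball2_mass n j x `^ (q - 1)))))).
  rewrite /fibre_sum exchange_big /=; apply: ler_sum => x _.
  rewrite -mulr_sumr ler_wpM2l//.
  have fm0 i : 0 <= fibre_mass w (c i) (c i x) by exact: fibre_mass_ge0.
  apply: (le_trans (powR_sum_concave th0 th1 fm0 P_gt0)).
  rewrite ler_wpM2l ?(ltW PR)//.
  have d0 j : 0 <= 2 ^- j * ball2_mass n j x by rewrite mulr_ge0 ?invr_ge0 ?exprn_ge0.
  have W0 : 0 <= \sum_(j < n.+1) 2 ^- j * ball2_mass n j x by apply: sumr_ge0.
  apply: (@le_trans _ _ ((C1 * \sum_(j < n.+1) 2 ^- j * ball2_mass n j x) `^ (q - 1))).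
    apply: le_powR; [exact: ltW| |].
      by rewrite divr_ge0 ?(ltW PR)// sumr_ge0.
    by rewrite ler_pdivrMr// [leRHS]mulrC mulrA; exact: (sum_fibre_mass_le x g0 gn Pg sS sep).
  rewrite powRM ?(ltW C10)// ler_wpM2l ?powR_ge0//.
  have := @powR_sum_le _ 'I_n.+1 xpredT (fun j => 2 ^- j * ball2_mass n j x) _ th0
    (fun j _ => d0 j).
  rewrite card_ord => /le_trans; apply.
  have -> : \sum_(j < n.+1) (2 ^- j * ball2_mass n j x) `^ (q - 1) =
      \sum_(j < n.+1) (2 ^- j) `^ (q - 1) * ball2_mass n j x `^ (q - 1).
    by apply: eq_bigr => j _; rewrite powRM ?invr_ge0 ?exprn_ge0.
  apply: ler_wpM2r.
    by apply: sumr_ge0 => j _; rewrite mulr_ge0 ?powR_ge0.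
  by apply: ler1_powR => //; rewrite ler1n.
rewrite [leLHS](_ : _ = C1 `^ (q - 1) * (P%:R * n.+1%:R *
   \sum_(j < n.+1) (2 ^- j) `^ (q - 1) * \sum_x w x * ball2_mass n j x `^ (q - 1))); last first.
  under [in RHS]eq_bigr do rewrite mulr_sumr.
  rewrite exchange_big /= !mulr_sumr; apply: eq_bigr => x _.
  rewrite !mulr_sumr; apply: eq_bigr => j _; ring.
rewrite ler_wpM2l ?powR_ge0//.
rewrite [leRHS](_ : _ = P%:R * n.+1%:R * \sum_(j < n.+1) (2 ^- j) `^ (q - 1) *
    (S * S * (D1 * D2) * (Lq_sum (projection a t P1) q (n - j) *
      Lq_sum (projection b u P2) q (n - j)))); last first.
  rewrite !mulr_sumr; apply: eq_bigr => j _; ring.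
apply: ler_wpM2l; first by rewrite mulr_ge0 ?ler0n.
apply: ler_sum => j _; rewrite ler_wpM2l ?powR_ge0//.
have jn : (2 : R) ^+ (n - j) <= 2 ^+ n by rewrite ler_weXn2l ?ler1n// leq_subr.
have [_ h1] := hD1 (n - j)%N m (le_trans (ler_wpM2r (exprn_ge0 m (ltW a0)) jn) nm).
have [_ h2] := hD2 (n - j)%N l (le_trans (ler_wpM2r (exprn_ge0 l (ltW b0)) jn) nl).
have p1 v : 0 <= @weight_tuple R k1 P1 m v by exact: weight_ge0.
have p2 v : 0 <= @weight_tuple R k2 P2 l v by exact: weight_ge0.
have -> : \sum_x w x * ball2_mass n j x `^ (q - 1) =
    ball_sum q (@weight_tuple R k1 P1 m) (@word_cell R k1 a t (n - j) m) M *
    ball_sum q (@weight_tuple R k2 P2 l) (@word_cell R k2 b u (n - j) l) M.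
  rewrite /ball_sum big_distrlr /= pair_bigA /=; apply: eq_bigr => -[v v'] _ /=.
  by rewrite /ball2_mass powRM ?ball_mass_ge0// /w /pair_weight /=; ring.
have b1le := ball_sum_le q1 (@word_cell R k1 a t (n - j) m) M p1.
have b2le := ball_sum_le q1 (@word_cell R k2 b u (n - j) l) M p2.
have bs_ge0 (X : finType) (p : X -> R) (d : X -> int) :
    (forall x, 0 <= p x) -> 0 <= ball_sum q p d M.
  by move=> p0; apply: sumr_ge0 => v _; rewrite mulr_ge0 ?powR_ge0.
rewrite [leRHS](_ : _ = (S * (D1 * Lq_sum (projection a t P1) q (n - j))) *
  (S * (D2 * Lq_sum (projection b u P2) q (n - j)))); last by ring.
apply: ler_pM; rewrite ?bs_ge0//.
  by apply: (le_trans b1le); rewrite ler_wpM2l ?(ltW S0).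
by apply: (le_trans b2le); rewrite ler_wpM2l ?(ltW S0).
Qed.

End marstrand.
(** * Subadditive sequences and rational approximation *)

Section real_tools.
Context {R : realType}.

Lemma eventually_le (A e : R) : 0 < e -> exists N : nat, forall n, (N <= n)%N -> A <= e * n%:R.
Proof.
move=> e0; exists (Num.trunc (A / e)).+1 => n Nn.
rewrite mulrC -ler_pdivrMr//; apply: (le_trans (ltW (truncnS_gt _))).
by rewrite ler_nat.
Qed.

(** The logarithm of a mean is at least the mean of the logarithms, from
    ln x <= x - 1. *)
Lemma sum_ln_le (P : nat) (y : nat -> R) (A : R) : (0 < P)%N -> 0 < A ->
  (forall i : 'I_P, 0 < y i) -> \sum_(i < P) y i <= P%:R * A ->
  \sum_(i < P) ln (y i) <= P%:R * ln A.
Proof.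
move=> P0 A0 y0 yA.
have -> : P%:R * ln A = \sum_(i < P) ln A by rewrite sumr_const card_ord mulr_natl.
rewrite -subr_le0 -sumrB.
apply: (@le_trans _ _ (\sum_(i < P) (y i / A - 1))).
  apply: ler_sum => i _.
  rewrite -ln_div ?posrE//.
  have yA0 : 0 < y i / A by rewrite divr_gt0.
  have := @le_ln1Dx _ (y i / A - 1); rewrite addrCA subrr addr0; apply.
  by move: yA0; lra.
rewrite sumrB -mulr_suml sumr_const card_ord subr_le0.
by rewrite ler_pdivrMr.
Qed.

(** The error term C is absorbed by adding it to x; the lower bound makes the limit
    finite. *)
Lemma fekete (x : nat -> R) (C B : R) :
  (forall m n, x (m + n)%N <= x m + x n + C) -> (forall n, - (B * n.+1%:R) <= x n) ->
  exists L, forall e, 0 < e -> exists N : nat, forall n, (N <= n)%N ->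
    `|x n - L * n%:R| <= e * n%:R.
Proof.
move=> xD xB; pose y n := x n + C.
have yD m n : y (m + n)%N <= y m + y n by rewrite /y; have := xD m n; lra.
pose S := [set y n.+1 / n.+1%:R | n in [set: nat]].
have S_inf : has_inf S.
  split; first by exists (y 1%N / 1%:R); exists 0%N.
  exists (- (2 * `|B| + `|C|)) => _ [n _ <-].
  rewrite ler_pdivlMr ?ltr0n//.
  have := xB n.+1; rewrite /y -(natr1 n.+1) => h.
  have n1 : (1 : R) <= n.+1%:R by rewrite ler1n.
  set z := n.+1%:R in h n1 *.
  have hB : B * (z + 1) <= `|B| * (2 * z).
    apply: (@le_trans _ _ (`|B| * (z + 1))).
      by rewrite ler_wpM2r ?ler_norm// addr_ge0// (le_trans ler01).
    by rewrite ler_wpM2l//; lra.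
  have hC : `|C| <= `|C| * z by rewrite ler_peMr.
  have := ler_norm (- C); rewrite normrN; lra.
pose L := inf S; exists L => e e0.
have L_le n : L * n%:R <= y n + `|C| + `|x 0%N|.
  case: n => [|n].
    rewrite mulr0 /y; have := ler_norm (- C); have := ler_norm (- x 0%N).
    by rewrite !normrN; lra.
  have : L <= y n.+1 / n.+1%:R by apply: ge_inf; [exact: S_inf.2|exists n].
  by rewrite ler_pdivlMr ?ltr0n// => h; have := normr_ge0 C; have := normr_ge0 (x 0%N); lra.
have e2 : 0 < e / 2 by rewrite divr_gt0.
have [_ [N _ <-] ] := inf_adherent e2 S_inf; rewrite -/L.
set M := N.+1; rewrite ltr_pdivrMr ?ltr0n// => yM.
have yMk k r : y (k * M + r)%N <= k%:R * y M + y r.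
  elim: k => [|k ih]; first by rewrite mul0n add0n mul0r add0r.
  rewrite mulSn -addnA; apply: (le_trans (yD _ _)).
  by rewrite -natr1 mulrDl mul1r; move: ih; lra.
pose Y : R := \sum_(r < M) `|y r|.
pose K := Y + M%:R * `|L + e / 2| + 2 * `|C| + `|x 0%N|.
have [N1 hN1] := eventually_le K e2.
exists N1 => n Nn; have Kn := hN1 n Nn.
have Y0 : 0 <= Y by apply: sumr_ge0.
have nC := ler_norm C; have nC' := ler_norm (- C); rewrite normrN in nC'.
have nM : 0 <= M%:R * `|L + e / 2| by rewrite mulr_ge0.
have nx := normr_ge0 (x 0%N).
have e0n : 0 <= e / 2 * n%:R by rewrite mulr_ge0// ltW.
rewrite ler_norml; apply/andP; split.
  have := L_le n; rewrite /y /K in Kn *; lra.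
have rM : (n %% M < M)%N by rewrite ltn_pmod.
have yr : y (n %% M)%N <= Y.
  rewrite /Y (bigD1 (Ordinal rM))//=; apply: (le_trans (ler_norm _)).
  by rewrite lerDl sumr_ge0.
have := yMk (n %/ M)%N (n %% M)%N; rewrite -divn_eq => yn.
have nE : n%:R = (n %/ M)%:R * M%:R + (n %% M)%:R :> R.
  by rewrite {1}(divn_eq n M) natrD natrM.
have k0 : (0 : R) <= (n %/ M)%:R by exact: ler0n.
have h1 : (n %/ M)%:R * y M <= (n %/ M)%:R * ((e / 2 + L) * M%:R).
  by rewrite ler_wpM2l//; move: yM; lra.
have h2 : (n %/ M)%:R * ((e / 2 + L) * M%:R) = (L + e / 2) * n%:R - (L + e / 2) * (n %% M)%:R.
  by rewrite nE; ring.
have h3 : - ((L + e / 2) * (n %% M)%:R) <= M%:R * `|L + e / 2|.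
  rewrite -mulNr; apply: (@le_trans _ _ (`|L + e / 2| * (n %% M)%:R)).
    by rewrite ler_wpM2r// -normrN ler_norm.
  by rewrite mulrC ler_wpM2r// ler_nat ltnW.
have yE : y n = x n + C by [].
by rewrite /K in Kn; lra.
Qed.

(** Pigeonhole on the fractional parts of the multiples of rho. *)
Lemma dirichlet (rho d : R) : 0 < rho -> 0 < d -> @irrational R rho ->
  exists k p : nat, [/\ (0 < k)%N, k%:R * rho - p%:R != 0 & `|k%:R * rho - p%:R| <= d].
Proof.
move=> rho0 d0 irr.
have [Q hQ] := eventually_le 1 d0.
pose Q1 := Q.+1; have Q10 : (0 : R) < Q1%:R by rewrite ltr0n.
have dQ : Q1%:R^-1 <= d by rewrite -[X in X <= _]mul1r ler_pdivrMr// hQ.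
pose fr (i : nat) : R := i%:R * rho - (Num.trunc (i%:R * rho))%:R.
have fr_itv i : 0 <= fr i < 1.
  have i0 : 0 <= i%:R * rho by rewrite mulr_ge0// ltW.
  by have /andP[h1 h2] := truncn_itv i0; rewrite /fr subr_ge0 h1 ltrBlDr addrC natr1.
pose f (i : 'I_Q1.+1) : 'I_Q1 := inord (Num.trunc (Q1%:R * fr i)).
have f_lt (i : 'I_Q1.+1) : (Num.trunc (Q1%:R * fr i) < Q1)%N.
  have /andP[h1 h2] := fr_itv i.
  by rewrite truncn_lt_nat ?mulr_ge0// gtr_pMr.
have /injectivePn[i [j ij fij]] : ~~ injectiveb f.
  by apply/negP => /injectiveP /leq_card; rewrite !card_ord ltnn.
wlog lt_ij : i j ij fij / (i < j)%N.
  move=> h; case: (ltngtP i j) => [|ji|/val_inj E]; [exact: h| |].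
    by apply: (h j i); rewrite // eq_sym.
  by rewrite E eqxx in ij.
have fr_close : `|fr j - fr i| <= d.
  apply: le_trans dQ.
  have := congr1 val fij; rewrite /= !inordK ?f_lt// => tE.
  have /andP[i0 _] := fr_itv i; have /andP[j0 _] := fr_itv j.
  have /andP[i1 i2] := truncn_itv (mulr_ge0 (ltW Q10) i0).
  have /andP[j1 j2] := truncn_itv (mulr_ge0 (ltW Q10) j0).
  rewrite -[leRHS]mul1r ler_pdivlMr// -[X in _ * X](gtr0_norm Q10) -normrM ler_norml.
  by move: i1 i2 j1 j2; rewrite tE -!natr1; lra.
exists (j - i)%N, (Num.trunc (j%:R * rho) - Num.trunc (i%:R * rho))%N.
have tle : (Num.trunc (i%:R * rho) <= Num.trunc (j%:R * rho))%N.
  by apply: le_truncn; rewrite ler_wpM2r ?(ltW rho0)// ler_nat ltnW.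
split; first by rewrite subn_gt0.
  rewrite subr_eq0; apply/negP => /eqP E; apply: irr; apply/rationalP.
  exists (Num.trunc (j%:R * rho) - Num.trunc (i%:R * rho))%N%:Z, (j - i)%N.
  have ji0 : (j - i)%:R != 0 :> R by rewrite pnatr_eq0 -lt0n subn_gt0.
  transitivity ((j - i)%:R * rho / (j - i)%:R); first by rewrite mulrAC divff// mul1r.
  by rewrite E.
by rewrite !natrB ?(ltnW lt_ij)//; move: fr_close; rewrite /fr; congr (`| _ | <= _); ring.
Qed.

End real_tools.
(** * Averaging along the irrational rotation *)

Section rotation.
Context {R : realType}.
Variables (E : R -> nat -> R) (E1 E2 : nat -> R) (a b q l1 l2 : R).
Hypotheses (a0 : 0 < a) (ab : a < b) (b1 : b < 1).
Hypothesis irr : @irrational R (ln a / ln b).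
Hypothesis E_gt0 : forall (s : R) n, 0 <= s -> 0 < E s n.
Hypotheses (E1_gt0 : forall n, 0 < E1 n) (E2_gt0 : forall n, 0 < E2 n).
Hypothesis E_upper : forall Sg : R, 0 <= Sg -> exists2 C : R, 0 < C &
  forall (s : R) n, 0 <= s <= Sg -> E s n <= C.
Hypothesis E_lower : forall Sg : R, 0 <= Sg -> exists2 c : R, 0 < c &
  forall (s : R) n, 0 <= s <= Sg -> c * (2 ^+ n) `^ (1 - q) <= E s n.
Hypothesis E_product : forall Sg : R, 0 <= Sg -> exists2 c : R, 0 < c &
  forall (s : R) n, 0 <= s <= Sg -> c * (E1 n * E2 n) <= E s n.
Hypothesis E_cocycle : forall Sg : R, 0 <= Sg -> exists2 C : R, 0 < C &
  forall n n' m l (s s' : R), 0 <= s <= Sg -> 0 <= s' <= Sg ->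
  a <= 2 ^+ n * a ^+ m <= 1 -> s * b ^+ l = s' * a ^+ m ->
  E s (n + n') <= C * (E s n * E s' n').
Hypothesis E_mean : forall Sg c0 : R, 0 <= Sg -> 0 < c0 -> exists2 C : R, 0 < C &
  forall (n P : nat) (s : nat -> R) (g : R),
  (0 < P)%N -> 0 < g -> g <= 2 ^- n -> c0 <= P%:R * g ->
  (forall i : 'I_P, 0 <= s i <= Sg) ->
  (forall i j : 'I_P, `|i%:R - j%:R| * g <= `|s i - s j|) ->
  \sum_(i < P) E (s i) n <=
  C * (P%:R * n.+1%:R * \sum_(j < n.+1) (2 ^- j) `^ (q - 1) * (E1 (n - j) * E2 (n - j))).
Hypothesis E1_rate : forall e, 0 < e -> exists N : nat, forall n, (N <= n)%N ->
  `|ln (E1 n) - l1 * n%:R| <= e * n%:R.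
Hypothesis E2_rate : forall e, 0 < e -> exists N : nat, forall n, (N <= n)%N ->
  `|ln (E2 n) - l2 * n%:R| <= e * n%:R.

Let mu : R := (q - 1) * ln 2.
Let al : R := - ln a.
Let be : R := - ln b.
Let lam : R := Num.min (- (l1 + l2)) mu.

Let b0 : 0 < b. Proof. exact: lt_trans ab. Qed.
Let a1 : a < 1. Proof. exact: lt_trans b1. Qed.
Let be0 : 0 < be. Proof. by rewrite oppr_gt0 ln_lt0// b0 b1. Qed.
Let ln20 : 0 < ln (2 : R). Proof. by rewrite ln_gt0// ltr1n. Qed.

Lemma product_rate e : 0 < e -> exists K : R, forall n,
  ln (E1 n) + ln (E2 n) <= (l1 + l2 + e) * n%:R + K.
Proof.
move=> e0; have e2 : 0 < e / 2 by rewrite divr_gt0.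
have [N1 h1] := E1_rate e2; have [N2 h2] := E2_rate e2.
pose N := maxn N1 N2; pose f n := ln (E1 n) + ln (E2 n) - (l1 + l2 + e) * n%:R.
exists (\sum_(i < N) `|f i|) => n; rewrite -lerBlDl -/(f n).
have [nN|Nn] := ltnP n N.
  rewrite (bigD1 (Ordinal nN))//=; apply: (le_trans (ler_norm _)).
  by rewrite lerDl sumr_ge0.
apply: (@le_trans _ _ 0); last exact: sumr_ge0.
have := h1 n (leq_trans (leq_maxl _ _) Nn); have := h2 n (leq_trans (leq_maxr _ _) Nn).
rewrite !ler_norml /f; lra.
Qed.

Lemma pow_mu (j : nat) : ((2 : R) ^- j) `^ (q - 1) = expR (- (mu * j%:R)).
Proof.
rewrite /powR gt_eqF ?invr_gt0 ?exprn_gt0// lnV ?posrE ?exprn_gt0// lnXn//.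
by congr expR; rewrite /mu -[_ *+ j]mulr_natr; ring.
Qed.

(** The term of scale j in the bound of the projection theorem is about
    exp(-j mu - (n - j)(D1 + D2) mu) with mu = (q-1) ln 2, a weighted geometric
    mean of the two extreme cases j = 0 and j = n, hence at most exp(-n lam);
    the polynomial factors are absorbed in eps. *)
Lemma mean_ln_E (Sg c0 e : R) : 0 <= Sg -> 0 < c0 -> 0 < e ->
  exists n0 : nat, forall (n P : nat) (s : nat -> R) (g : R), (n0 <= n)%N ->
  (0 < P)%N -> 0 < g -> g <= 2 ^- n -> c0 <= P%:R * g ->
  (forall i : 'I_P, 0 <= s i <= Sg) ->
  (forall i j : 'I_P, `|i%:R - j%:R| * g <= `|s i - s j|) ->
  \sum_(i < P) ln (E (s i) n) <= P%:R * (- (lam - e) * n%:R).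
Proof.
move=> Sg0 c00 e0; have [C C0 hC] := E_mean Sg0 c00.
have e4 : 0 < e / 4 by rewrite divr_gt0.
have [K hK] := product_rate e4.
pose tt : R := e / 8; have t0 : 0 < tt by rewrite divr_gt0.
have e2 : 0 < e / 2 by rewrite divr_gt0.
have [n0 hn0] := eventually_le (ln C + K + e / 4 - 2 - 2 * ln tt) e2.
exists n0 => n P s g n0n P0 g0 gn Pg sS sep.
pose A : R := C * (n.+1%:R * n.+1%:R * expR (K - (lam - e / 4) * n%:R)).
have nR : (0 : R) < n.+1%:R by rewrite ltr0n.
have A0 : 0 < A by rewrite !mulr_gt0 ?expR_gt0.
have PR : (0 : R) <= P%:R by exact: ler0n.
have EA : \sum_(i < P) E (s i) n <= P%:R * A.
  apply: (le_trans (hC n P s g P0 g0 gn Pg sS sep)).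
  rewrite /A [leRHS]mulrCA ler_wpM2l ?(ltW C0)// -!mulrA ler_wpM2l// ler_wpM2l ?(ltW nR)//.
  rewrite [leRHS](_ : _ = \sum_(j < n.+1) expR (K - (lam - e / 4) * n%:R)); last first.
    by rewrite sumr_const card_ord mulr_natl.
  apply: ler_sum => j _; rewrite pow_mu -[E1 _]lnK ?posrE// -[E2 _]lnK ?posrE//.
  rewrite -!expRD ler_expR.
  have jn : (j <= n)%N by rewrite -ltnS.
  have := hK (n - j)%N; rewrite natrB// => h.
  have j0 : (0 : R) <= j%:R by exact: ler0n.
  have jnR : (j%:R : R) <= n%:R by rewrite ler_nat.
  have lam1 : lam <= - (l1 + l2) by rewrite ge_min lexx.
  have lam2 : lam <= mu by rewrite ge_min lexx orbT.
  have g1 : lam * j%:R <= mu * j%:R by rewrite ler_wpM2r.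
  have g2 : lam * (n%:R - j%:R) <= - (l1 + l2) * (n%:R - j%:R).
    by rewrite ler_wpM2r// subr_ge0.
  have g3 : e / 4 * (n%:R - j%:R) <= e / 4 * n%:R.
    by rewrite ler_wpM2l ?(ltW e4)// lerBlDr lerDl.
  by move: h g1 g2 g3; lra.
have sum_le := @sum_ln_le _ P (fun i => E (s i) n) A P0 A0.
apply: (le_trans (sum_le _ EA)); first by move=> i; apply: E_gt0; have /andP[] := sS i.
rewrite ler_wpM2l//.
rewrite /A !lnM ?posrE ?mulr_gt0 ?expR_gt0// expRK.
(* A linear bound on ln (n + 1) with arbitrarily small slope tt. *)
have ln_n : ln (n.+1%:R : R) <= tt * n.+1%:R - 1 - ln tt.
  have := @le_ln1Dx _ (tt * n.+1%:R - 1); rewrite addrCA subrr addr0 lnM ?posrE//.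
  have := mulr_gt0 t0 nR; set z := tt * _ => z0 h.
  have {}h := h (_ : -1 < z - 1).
  have : ln tt + ln (n.+1%:R : R) <= z - 1 by apply: h; lra.
  lra.
have := hn0 n n0n; move: ln_n; rewrite -(natr1 n) /tt; lra.
Qed.

Let G (x : R) (n : nat) : R := ln (E (expR x) n).

(** The cocycle inequality in the coordinate x = ln s, where the change of
    parameter is the translation by m al - l be. *)
Lemma G_step (A : R) : exists2 c : R, 0 <= c & forall n n' m l (x x' : R),
  x <= A -> x' <= A -> a <= 2 ^+ n * a ^+ m <= 1 ->
  x' = x + m%:R * al - l%:R * be ->
  G x (n + n') <= c + G x n + G x' n'.
Proof.
have [C C0 hC] := E_cocycle (ltW (expR_gt0 A)).
exists `|ln C| => // n n' m l x x' xA x'A nm xx'.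
have rng y : y <= A -> 0 <= expR y <= expR A.
  by move=> yA; rewrite (ltW (expR_gt0 y)) ler_expR.
have hb y (r : R) j : 0 < r -> expR y * r ^+ j = expR (y + j%:R * ln r).
  by move=> r0; rewrite expRD expRM_natl lnK.
have h := hC n n' m l (expR x) (expR x') (rng _ xA) (rng _ x'A) nm.
have {}h : E (expR x) (n + n') <= C * (E (expR x) n * E (expR x') n').
  by apply: h; rewrite !hb// xx' /al /be; congr expR; ring.
have Ex y j : 0 < E (expR y) j by apply: E_gt0; exact/ltW/expR_gt0.
have : G x (n + n') <= ln C + (G x n + G x' n').
  by rewrite /G -!lnM ?posrE ?mulr_gt0// ler_ln ?posrE ?mulr_gt0.
have := ler_norm (ln C); lra.
Qed.

Lemma G_upper (A : R) : exists2 c : R, 0 <= c & forall x n, x <= A -> G x n <= c.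
Proof.
have [C C0 hC] := E_upper (ltW (expR_gt0 A)).
exists `|ln C| => // x n xA; apply: le_trans (ler_norm _).
rewrite /G ler_ln ?posrE//; last by apply: E_gt0; exact/ltW/expR_gt0.
by apply: hC; rewrite (ltW (expR_gt0 x)) ler_expR.
Qed.

(** Iterating the cocycle k times at the same scale n, where L i counts the letters
    of the second word that have been used after i steps. *)
Lemma G_block (A c : R) (n m k : nat) (L : nat -> nat) (x : R) (n' : nat) :
  (forall n n' m l (x x' : R),
    x <= A -> x' <= A -> a <= 2 ^+ n * a ^+ m <= 1 ->
    x' = x + m%:R * al - l%:R * be ->
    G x (n + n') <= c + G x n + G x' n') ->
  a <= 2 ^+ n * a ^+ m <= 1 -> L 0%N = 0%N ->
  (forall i, (i < k)%N -> (L i <= L i.+1)%N) ->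
  (forall i, (i <= k)%N -> x + (i%:R * (m%:R * al) - (L i)%:R * be) <= A) ->
  G x (k * n + n') <= k%:R * c +
    \sum_(i < k) G (x + (i%:R * (m%:R * al) - (L i)%:R * be)) n +
    G (x + (k%:R * (m%:R * al) - (L k)%:R * be)) n'.
Proof.
move=> step nm L0; elim: k n' => [|k ih] n' Lmono xA.
  by rewrite mul0n add0n big_ord0 L0 !mul0r subrr !addr0 !add0r.
rewrite mulSn -addnA addnCA.
apply: (le_trans (ih (n + n')%N _ _)).
- by move=> i ik; apply: Lmono; rewrite ltnW.
- by move=> i ik; apply: xA; rewrite leqW.
rewrite big_ord_recr /= -natr1.
set y := x + (k%:R * _ - _).
set z := x + ((k%:R + 1) * _ - _).
have := step n n' m (L k.+1 - L k)%N y z (xA k (leqnSn k)).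
rewrite /z natr1 => /(_ (xA k.+1 (leqnn _)) nm) h.
have {}h := h (_ : _ = _).
have {}h : G y (n + n') <= c + G y n + G (x + (k.+1%:R * (m%:R * al) - (L k.+1)%:R * be)) n'.
  by apply: h; rewrite /y natrB ?Lmono// -natr1; ring.
move: h; rewrite -natr1; lra.
Qed.

(** Equally spaced points of the circle remain separated as dilation
    parameters. *)
Lemma expR_lipschitz_lower (v u w : R) : v <= u -> v <= w ->
  expR v * `|u - w| <= `|expR u - expR w|.
Proof.
wlog wu : u w / w <= u.
  move=> h vu vw; have [|/ltW] := leP w u; first by move=> ?; exact: h.
  by move=> uw; rewrite distrC [leRHS]distrC; exact: h.
move=> vu vw; rewrite !ger0_norm ?subr_ge0 ?ler_expR//.
have -> : expR u = expR w * expR (u - w) by rewrite -expRD addrC subrK.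
apply: (@le_trans _ _ (expR w * (u - w))).
  by rewrite ler_wpM2r ?subr_ge0// ler_expR.
have := expR_ge1Dx (u - w); have := expR_gt0 w.
set p := expR w; set r := expR _; move=> p0 hr.
rewrite -[X in _ <= _ - X]mulr1 -mulrBr ler_wpM2l ?(ltW p0)//; lra.
Qed.

(** The block of length T consists of P rounds of k steps, and one last step that
    brings the parameter back into [0, be[.  After k steps the parameter has
    moved by phi, so for each i < k the parameters visited at the i-th step of the
    successive rounds form a progression of step phi; P is chosen so that it
    covers the circle once, and mean_ln_E applies to it. *)
Lemma G_orbit_gain (e : R) : 0 < e -> exists (T : nat) (c : R),
  [/\ (0 < T)%N, 0 <= c, (forall x n, 0 <= x < be -> G x n <= c) &
   forall x n', 0 <= x < be -> exists2 x', 0 <= x' < be &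
    G x (T + n') <= - (lam - 3 * e) * T%:R + G x' n'].
Proof.
move=> e0; pose A := 4 * be.
have [c c_ge0 step] := G_step A; have [c1 c1_ge0 up] := G_upper A.
have eb0 : 0 < expR (- be) by exact: expR_gt0.
have c00 : 0 < expR (- be) * be by rewrite mulr_gt0.
have [n0 hn0] := mean_ln_E (ltW (expR_gt0 A)) c00 e0.
have [n1 hn1] := eventually_le (c + c1) e0.
have [n2 hn2] := eventually_le lam (mulr_gt0 e0 be0).
have [n3 hn3] := eventually_le (3 * be) ln20.
have [n [n0n n1n n2n [n3n n_gt0]]] : exists n, [/\ n0 <= n, n1 <= n, n2 <= n &
    n3 <= n /\ 0 < n]%N.
  by exists (n0 + n1 + n2 + n3).+1; clear; split; [| | |split]; lia.
have {}hn1 := hn1 n n1n.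
have {}hn2 := hn2 n n2n.
have {}hn3 := hn3 n n3n.
have [m nm] := level_exists n a0 a1.
have mal : 3 * be <= m%:R * al.
  apply: (le_trans hn3).
  have /andP[_] := nm; rewrite -ler_ln ?posrE ?mulr_gt0 ?exprn_gt0// ln1.
  by rewrite lnM ?posrE ?exprn_gt0// !lnXn// -(mulr_natr (ln a)) -(mulr_natr (ln 2)) /al; lra.
pose rho := m%:R * al / be.
have rho3 : 3 <= rho by rewrite ler_pdivlMr.
have rho0 : 0 < rho by lra.
have rho_irr : @irrational R rho.
  move=> /rationalP[z [j rhoE]]; apply: irr; apply/rationalP.
  exists z, (j * m)%N.
  have m0 : m%:R != 0 :> R.
    by apply/eqP => m0; move: mal; rewrite m0 mul0r; move: be0; lra.
  have -> : ln a / ln b = rho / m%:R.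
    have lnb0 : ln b != 0 by rewrite -oppr_eq0 gt_eqF.
    by rewrite /rho /al /be; field; rewrite ?m0 ?lnb0.
  by rewrite rhoE natrM invfM mulrA.
pose d : R := Num.min (2 ^- n / be) 1.
have d0 : 0 < d by rewrite lt_min ltr01 divr_gt0 ?invr_gt0 ?exprn_gt0.
have [k [p [k0 phi_neq phi_d]]] := dirichlet rho0 d0 rho_irr.
pose phi := k%:R * (m%:R * al) - p%:R * be.
have phiE : phi = (k%:R * rho - p%:R) * be.
  by rewrite /phi /rho; field; rewrite gt_eqF.
have phi0 : 0 < `|phi|.
  by rewrite normr_gt0 phiE mulf_neq0// gt_eqF.
have phi_n : `|phi| <= 2 ^- n.
  rewrite phiE normrM (gtr0_norm be0) -ler_pdivlMr//; apply: (le_trans phi_d).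
  by rewrite ge_min lexx.
have phi_be : `|phi| <= be.
  rewrite phiE normrM (gtr0_norm be0) ler_piMl ?(ltW be0)//; apply: (le_trans phi_d).
  by rewrite ge_min lexx orbT.
have bphi0 : 0 <= be / `|phi| by rewrite divr_ge0 ?(ltW be0) ?(ltW phi0).
pose P := (Num.trunc (be / `|phi|)).+1.
have P_ge : be <= P%:R * `|phi|.
  by rewrite -ler_pdivrMr//; apply: ltW; exact: truncnS_gt.
have P_le l : (l < P)%N -> l%:R * `|phi| <= be.
  move=> lP; rewrite -ler_pdivlMr//.
  by apply: (@le_trans _ _ (Num.trunc (be / `|phi|))%:R); rewrite ?ler_nat// truncn_le.
(* L k is p and not the integer part of k rho, which may be p - 1 when phi is
   negative: the block has to end at distance |phi| from its start. *)
pose L i := if (i < k)%N then Num.trunc (i%:R * rho) else p.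
have irho (i : nat) : 0 <= i%:R * rho by rewrite mulr_ge0 ?ler0n ?(ltW rho0).
have L0 : L 0%N = 0%N by rewrite /L k0 mul0r truncn0.
have Lmono i : (i < k)%N -> (L i <= L i.+1)%N.
  move=> ik; rewrite /L ik; case: ltnP => ik1.
    by apply: le_truncn; rewrite ler_wpM2r ?(ltW rho0)// ler_nat.
  have kE : k = i.+1 by apply/eqP; rewrite eqn_leq ik ik1.
  rewrite -(ler_nat R); apply: (@le_trans _ _ (i%:R * rho)); first by rewrite truncn_le.
  have d1 : d <= 1 by rewrite ge_min lexx orbT.
  move: (le_trans phi_d d1); rewrite kE ler_norml -natr1; move: rho3; lra.
pose z i := i%:R * (m%:R * al) - (L i)%:R * be.
have zk : z k = phi by rewrite /z /L ltnn.
have z_itv i : (i < k)%N -> 0 <= z i <= be.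
  move=> ik; have /andP[h1 h2] := truncn_itv (irho i).
  have -> : z i = (i%:R * rho - (Num.trunc (i%:R * rho))%:R) * be.
    by rewrite /z /L ik /rho; field; rewrite gt_eqF.
  move: h2; rewrite -natr1 => h2.
  by rewrite mulr_ge0 ?subr_ge0 ?(ltW be0)//= ler_piMl ?(ltW be0)//; lra.
have lphi l : (l < P)%N -> - be <= l%:R * phi <= be.
  by move=> lP; rewrite -ler_norml normrM ger0_norm// P_le.
exists ((P * k).+1 * n)%N, c1; split.
- by rewrite muln_gt0.
- exact: c1_ge0.
- by move=> x n' /andP[x0 xb]; apply: up; rewrite /A; move: be0; lra.
move=> x n' /andP[x0 xb].
have x_z l i : (l < P)%N -> (i < k)%N -> - be <= x + l%:R * phi + z i <= A.
  move=> lP ik; have /andP[h1 h2] := lphi l lP; have /andP[h3 h4] := z_itv i ik.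
  by rewrite /A; move: be0; lra.
have orbit P' n'' : (P' <= P)%N -> G x (P' * (k * n) + n'') <=
    P'%:R * (k%:R * c) + \sum_(l < P') \sum_(i < k) G (x + l%:R * phi + z i) n +
    G (x + P'%:R * phi) n''.
  elim: P' n'' => [|P' ih] n'' PP; first by rewrite mul0n add0n big_ord0 !mul0r !add0r addr0.
  rewrite mulSn -addnA addnCA; apply: (le_trans (ih (k * n + n'')%N (ltnW PP))).
  have yA i : (i <= k)%N -> x + P'%:R * phi + (i%:R * (m%:R * al) - (L i)%:R * be) <= A.
    rewrite leq_eqVlt => /predU1P[->|ik]; last by have /andP[] := x_z P' i PP ik.
    rewrite -/(z k) zk; have /andP[_ h] := lphi P' PP.
    by have := ler_norm phi; rewrite /A; move: be0 phi_be; lra.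
  have := @G_block A c n m k L (x + P'%:R * phi) n'' step nm L0 Lmono yA.
  rewrite -/(z k) zk big_ord_recr /= -(natr1 P').
  have -> : x + (P'%:R + 1) * phi = x + P'%:R * phi + phi by ring.
  rewrite -/z; set S1 := \sum_(i < k) _; set S2 := \sum_(i < P') _; lra.
pose X := x + P%:R * phi.
have X_itv : - (2 * be) <= X <= 3 * be.
  have /andP[h1 h2] := lphi (Num.trunc (be / `|phi|)) (ltnSn _).
  move: phi_be; rewrite ler_norml /X /P -natr1; move: h1 h2; lra.
have /andP[X1 X2] := X_itv.
have Xm0 : 0 <= (X + m%:R * al) / be.
  by apply: divr_ge0; [move: mal be0; lra|exact: ltW].
pose l := Num.trunc ((X + m%:R * al) / be).
pose x' := X + m%:R * al - l%:R * be.
have x'_itv : 0 <= x' < be.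
  have /andP[h1 h2] := truncn_itv Xm0; rewrite -/l in h1 h2.
  move: h1 h2; rewrite ler_pdivlMr// ltr_pdivrMr// /x' -natr1; lra.
exists x' => //.
rewrite mulSn -addnA addnCA -mulnA.
have h1 := orbit P (n + n')%N (leqnn P).
have h2 : G X (n + n') <= c + G X n + G x' n'.
  by apply: (step n n' m l X x' _ _ nm erefl); have /andP[] := x'_itv;
    rewrite /A; move: be0; lra.
have h3 : G X n <= c1 by apply: up; rewrite /A; move: be0; lra.
have h4 : \sum_(l < P) \sum_(i < k) G (x + l%:R * phi + z i) n <=
    P%:R * k%:R * (- (lam - e) * n%:R).
  rewrite exchange_big /=.
  apply: (@le_trans _ _ (\sum_(i < k) P%:R * (- (lam - e) * n%:R))); last first.
    by rewrite sumr_const card_ord -(mulr_natr (P%:R * _)) mulrAC.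
  apply: ler_sum => i _.
  apply: (hn0 n P (fun l => expR (x + l%:R * phi + z i)) (expR (- be) * `|phi|)) => //.
  - by rewrite mulr_gt0.
  - apply: le_trans phi_n; rewrite ler_piMl//.
    by rewrite -expR0 ler_expR; move: be0; lra.
  - by rewrite mulrCA ler_wpM2l// ltW.
  - move=> l'; have /andP[_ h] := x_z l' i (ltn_ord _) (ltn_ord _).
    by rewrite ler_expR h ltW// expR_gt0.
  - move=> l' l''.
    have /andP[v1 _] := x_z l' i (ltn_ord _) (ltn_ord _).
    have /andP[v2 _] := x_z l'' i (ltn_ord _) (ltn_ord _).
    apply: le_trans (expR_lipschitz_lower v1 v2).
    rewrite mulrCA -normrM; apply: ler_wpM2l; first exact: ltW.
    by rewrite le_eqVlt; apply/orP; left; apply/eqP; congr `| _ |; ring.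
(* The number N of useful steps is at least be n, because the step phi is at
   most 2^-n; the constants and the loss of the last step are thus absorbed in
   2 eps. *)
set N : R := P%:R * k%:R in h4.
have P1 : (1 : R) <= P%:R by rewrite ler1n.
have k1 : (1 : R) <= k%:R by rewrite ler1n.
have n0R : (0 : R) <= n%:R by exact: ler0n.
have PN : P%:R <= N by rewrite /N ler_peMr// (le_trans ler01).
have N0 : 0 <= N by rewrite (le_trans _ PN)// (le_trans ler01).
have beN : be * n%:R <= N.
  apply: (@le_trans _ _ (be * 2 ^+ n)).
    by rewrite ler_wpM2l ?(ltW be0)// -natrX ler_nat ltnW// ltn_expl.
  apply: le_trans PN; rewrite -ler_pdivlMr ?exprn_gt0//.
  by apply: (le_trans P_ge); rewrite ler_wpM2l// (le_trans ler01).
have lamN : lam <= e * N.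
  apply: (le_trans hn2); rewrite -mulrA ler_wpM2l//; exact: ltW.
have i1 : n%:R * lam <= n%:R * (e * N) by rewrite ler_wpM2l.
have i2 : (N + 1) * (c + c1) <= (N + 1) * (e * n%:R) by rewrite ler_wpM2l// addr_ge0.
have i3 : 0 <= N * c1 by rewrite mulr_ge0.
have -> : (n + P * (k * n))%N%:R = (N + 1) * n%:R :> R by rewrite natrD !natrM /N; ring.
have e1 : P%:R * (k%:R * c) = N * c by rewrite /N mulrA.
rewrite e1 in h1; move: h1; rewrite -/X => h1.
move: h1 h2 h3 h4 i1 i2 i3; set S := \sum_(l < P) _; lra.
Qed.

Lemma G_rate (e : R) : 0 < e -> exists K : R, forall x n, 0 <= x < be ->
  G x n <= - (lam - e) * n%:R + K.
Proof.
move=> e0; have e3 : 0 < e / 3 by rewrite divr_gt0.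
have [T [c [T0 c0 up gain]]] := G_orbit_gain e3.
have e3E : 3 * (e / 3) = e by field.
rewrite e3E in gain.
have iter j r x : 0 <= x < be -> G x (j * T + r) <= - (lam - e) * (j * T)%:R + c.
  elim: j x => [|j ih] x xb; first by rewrite mul0n mulr0 add0r; exact: up.
  have [x' x'b] := gain x (j * T + r)%N xb; rewrite mulSn -addnA => h.
  apply: (le_trans h); have := ih x' x'b; rewrite natrD; lra.
exists (`|lam - e| * T%:R + c) => x n xb.
have := iter (n %/ T)%N (n %% T)%N x xb; rewrite -divn_eq => h; apply: (le_trans h).
rewrite addrA lerD2r {2}(divn_eq n T) natrD mulrDr -addrA lerDl.
have : (lam - e) * (n %% T)%:R <= `|lam - e| * T%:R.
  apply: (@le_trans _ _ (`|lam - e| * (n %% T)%:R)); first by rewrite ler_wpM2r// ler_norm.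
  by rewrite ler_wpM2l// ler_nat ltnW// ltn_pmod.
lra.
Qed.

(** A first step at a fixed scale n1 brings ln s into [0, be[ from any bounded
    interval, at a bounded cost; G_rate then gives the upper bound on ln E.  The
    lower bound is the elementary one. *)
Lemma uniform_rate (s1 s2 e : R) : 0 < s1 -> 0 < e -> exists N : nat, forall n s,
  (N <= n)%N -> s1 <= s <= s2 -> `|ln (E s n) + lam * n%:R| <= e * n%:R.
Proof.
move=> s10 e0; have e2 : 0 < e / 2 by rewrite divr_gt0.
have [s2_lt|s12] := ltP s2 s1.
  by exists 0%N => n s _ /andP[h1 h2]; have := le_trans h1 h2; rewrite leNgt s2_lt.
have s20 : 0 < s2 by exact: lt_le_trans s12.
pose A := `|ln s1| + `|ln s2| + be.
have [c c_ge0 step] := G_step A; have [c1 c1_ge0 up] := G_upper A.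
have [K hK] := G_rate e2.
have [n1 hn1] := eventually_le A ln20.
have {}hn1 := hn1 n1 (leqnn _).
have [m nm] := level_exists n1 a0 a1.
have mal : A <= m%:R * al.
  apply: (le_trans hn1).
  have /andP[_] := nm; rewrite -ler_ln ?posrE ?mulr_gt0 ?exprn_gt0// ln1.
  by rewrite lnM ?posrE ?exprn_gt0// !lnXn// -(mulr_natr (ln a)) -(mulr_natr (ln 2)) /al; lra.
have [cl cl0 hl] := E_lower (ltW s20).
have [cp cp0 hp] := E_product (ltW s20).
have [N1 h1] := E1_rate (divr_gt0 e0 (ltr0n R 4)).
have [N2 h2] := E2_rate (divr_gt0 e0 (ltr0n R 4)).
have [N3 h3] := eventually_le (c + c1 + `|K| + `|lam - e / 2| * n1%:R) e2.
have [N4 h4] := eventually_le (`|ln cl| + `|ln cp|) e2.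
exists (n1 + N1 + N2 + N3 + N4)%N => n s Nn /andP[ss1 ss2].
have n_n1 : (n1 <= n)%N by move: Nn; clear; lia.
have {}h1 := h1 n (ltac:(move: Nn; clear; lia)); have {}h2 := h2 n (ltac:(move: Nn; clear; lia)).
have {}h3 := h3 n (ltac:(move: Nn; clear; lia)); have {}h4 := h4 n (ltac:(move: Nn; clear; lia)).
have s0 : 0 < s by exact: lt_le_trans ss1.
have sr : 0 <= s <= s2 by rewrite ltW.
have En0 : 0 < E s n by apply: E_gt0; exact: ltW.
rewrite ler_norml; apply/andP; split.
  have lower1 : ln cl - mu * n%:R <= ln (E s n).
    have := hl s n sr; rewrite -ler_ln ?posrE ?mulr_gt0 ?powR_gt0 ?exprn_gt0//.
    rewrite lnM ?posrE ?powR_gt0 ?exprn_gt0// ln_powR lnXn// -(mulr_natr (ln 2)) /mu; lra.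
  have lower2 : ln cp + (ln (E1 n) + ln (E2 n)) <= ln (E s n).
    have := hp s n sr; rewrite -ler_ln ?posrE ?mulr_gt0//.
    by rewrite !lnM ?posrE ?mulr_gt0.
  have a1n := ler_norm (- ln cl); have a2n := ler_norm (- ln cp); rewrite !normrN in a1n a2n.
  have p1 := normr_ge0 (ln cl); have p2 := normr_ge0 (ln cp).
  have en0 : 0 <= e / 2 * n%:R by rewrite mulr_ge0// ltW.
  move: h1 h2; rewrite !ler_norml => h1 h2.
  rewrite /lam; case: (leP (- (l1 + l2)) mu) => _; lra.
pose x := ln s.
have xE : expR x = s by rewrite lnK ?posrE.
have ln1x : ln s1 <= x by rewrite ler_ln ?posrE.
have lnx2 : x <= ln s2 by rewrite ler_ln ?posrE.
have q1n := ler_norm (- ln s1); rewrite normrN in q1n.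
have q2n := ler_norm (ln s2); have q3 := normr_ge0 (ln s2); have q4 := normr_ge0 (ln s1).
have xA : x <= A by rewrite /A; move: be0; lra.
have xm0 : 0 <= (x + m%:R * al) / be.
  by apply: divr_ge0; [move: mal be0; rewrite /A; lra|exact: ltW].
pose l := Num.trunc ((x + m%:R * al) / be).
pose x' := x + m%:R * al - l%:R * be.
have x'_itv : 0 <= x' < be.
  have /andP[g1 g2] := truncn_itv xm0; rewrite -/l in g1 g2.
  move: g1 g2; rewrite ler_pdivlMr// ltr_pdivrMr// /x' -natr1; lra.
have x'A : x' <= A by have /andP[_ /ltW] := x'_itv; rewrite /A; lra.
have := step n1 (n - n1)%N m l x x' xA x'A nm erefl.
rewrite subnKC// {1}/G xE => g1.
have g2 := up x n1 xA; have g3 := hK x' (n - n1)%N x'_itv.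
rewrite natrB// in g3.
have g4 : (lam - e / 2) * n1%:R <= `|lam - e / 2| * n1%:R by rewrite ler_wpM2r// ler_norm.
have g5 := ler_norm K.
move: g1 g2 g3 g4 g5 h3; lra.
Qed.

End rotation.
(** * Existence of the dimensions and the formula *)

Section conclusion.
Context {R : realType}.

Lemma log2_quotient_dist (q x L e : R) (n : nat) : 1 < q -> (0 < n)%N ->
  `|x - L * n%:R| <= e * n%:R ->
  `|x / ln 2 / - (n%:R * (q - 1)) - - L / ((q - 1) * ln 2)| <= e / ((q - 1) * ln 2).
Proof.
move=> q1 n0 h.
have l2 : 0 < ln (2 : R) by rewrite ln_gt0// ltr1n.
have th0 : 0 < q - 1 by rewrite subr_gt0.
have nR : (0 : R) < n%:R by rewrite ltr0n.
have mu0 : 0 < (q - 1) * ln 2 by rewrite mulr_gt0.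
have -> : x / ln 2 / - (n%:R * (q - 1)) - - L / ((q - 1) * ln 2) =
    - (x - L * n%:R) / (n%:R * ((q - 1) * ln 2)).
  by field; rewrite !gt_eqF//.
rewrite normrM normrN [X in _ * X]gtr0_norm ?invr_gt0 ?mulr_gt0// ler_pdivrMr ?mulr_gt0//.
rewrite (_ : e / _ * _ = e * n%:R)//.
by field; rewrite !gt_eqF.
Qed.

Lemma Lq_quotient_cvg (rho : probability R R) (q L : R) : 1 < q ->
  (forall e, 0 < e -> exists N : nat, forall n, (N <= n)%N ->
    `|ln (Lq_sum rho q n) - L * n%:R| <= e * n%:R) ->
  Lq_quotient rho q n @[n --> \oo] --> - L / ((q - 1) * ln 2).
Proof.
move=> q1 rate; apply/cvgrPdist_le => e e0.
have mu0 : 0 < (q - 1) * ln (2 : R) by rewrite mulr_gt0 ?subr_gt0 ?ln_gt0 ?ltr1n.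
have [N hN] := rate _ (mulr_gt0 e0 mu0).
exists N.+1 => // n /= Nn; rewrite distrC.
have n0 : (0 < n)%N by apply: leq_trans Nn.
apply: (le_trans (log2_quotient_dist q1 n0 (hN n (ltnW Nn)))).
by rewrite mulfK// gt_eqF.
Qed.

(** The cocycle inequality at s = 0, where no condition links l to m. *)
Lemma projection_rate (k : nat) (a : R) (t : 'I_k.+1 -> R) (P : probability (words k) R)
    (q : R) : 0 < a -> a < 1 -> 1 < q -> submultiplicative P ->
  (forall n, 0 < Lq_sum (projection a t P) q n) /\
  exists L, forall e, 0 < e -> exists N : nat, forall n, (N <= n)%N ->
    `|ln (Lq_sum (projection a t P) q n) - L * n%:R| <= e * n%:R.
Proof.
move=> a0 a1 q1 subP.
have EE n : conv_sum a a t t P P q 0 n = Lq_sum (projection a t P) q n.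
  exact: convolution_projection0.
have r00 : (0 : R) <= (0 : R) <= (0 : R) by rewrite lexx.
have pos n : 0 < Lq_sum (projection a t P) q n.
  by rewrite -EE; apply: (conv_sum_gt0 t t P P a0 a1 a0 a1 q1 (lexx 0) n r00).
split => //.
have [C C0 hC] := conv_sum_cocycle t t 0 a0 a1 a0 a1 q1 subP subP.
have [c c0 hc] := conv_sum_lower t t P P a0 a1 a0 a1 q1 (lexx 0).
apply: (@fekete _ _ (ln C) (`|ln c| + (q - 1) * ln 2)) => [n n'|n].
  have [m nm] := level_exists n a0 a1.
  have := hC n n' m 0%N 0 0 r00 r00 nm; rewrite !mul0r !EE => /(_ erefl).
  rewrite -ler_ln ?posrE ?mulr_gt0//.
  by rewrite !lnM ?posrE ?mulr_gt0//; lra.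
have := hc 0 n r00; rewrite EE.
rewrite -ler_ln ?posrE ?mulr_gt0 ?powR_gt0 ?exprn_gt0//.
rewrite lnM ?posrE ?powR_gt0 ?exprn_gt0// ln_powR lnXn// -(mulr_natr (ln 2)).
have l2 : 0 < ln (2 : R) by rewrite ln_gt0// ltr1n.
have th0 : 0 < q - 1 by rewrite subr_gt0.
have mu0 := mulr_gt0 th0 l2.
have h1 := ler_norm (- ln c); rewrite normrN in h1.
have h2 : 0 <= `|ln c| * n%:R by rewrite mulr_ge0.
rewrite -(natr1 n); lra.
Qed.

Lemma compact_pos_bounds (S : set R) : compact S -> S `<=` [set s | 0 < s] ->
  exists s1 s2 : R, 0 < s1 /\ forall s, S s -> s1 <= s <= s2.
Proof.
move=> cS Spos.
have [->|S0] := eqVneq S set0; first by exists 1, 1.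
have {}S0 : S !=set0 by exact/set0P.
have cid : {within S, continuous (id : R -> R)}.
  by apply: continuous_subspaceT => x; exact: cvg_id.
have [c1 c1S min1] := compact_EVT_min S0 cS cid.
have [c2 c2S max2] := compact_EVT_max S0 cS cid.
exists c1, c2; split; first by apply: Spos; rewrite -inE.
by move=> s Ss; rewrite min1 ?inE// max2 ?inE.
Qed.

End conclusion.

Theorem corollary6p2 (R : realType) (k1 k2 : nat) (a b : R)
    (t : 'I_k1.+1 -> R) (u : 'I_k2.+1 -> R)
    (nubar1 : probability (words k1) R) (nubar2 : probability (words k2) R)
    (a_gt0 : 0 < a) (a_lt_b : a < b) (b_lt1 : b < 1)
    (nubar1_sub : submultiplicative nubar1)
    (nubar2_sub : submultiplicative nubar2)
    (irr : irrational (log2 a / log2 b)) :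
  let nu1 := projection a t nubar1 in
  let nu2 := projection b u nubar2 in
  forall q : R, 1 < q <= 2 ->
    [/\ cvgn (Lq_quotient nu1 q),
        cvgn (Lq_quotient nu2 q),
        (forall s : R, 0 < s ->
          cvgn (Lq_quotient (convolution nu1 (dilate s nu2)) q) /\
          Lq_dim (convolution nu1 (dilate s nu2)) q
            = Num.min (Lq_dim nu1 q + Lq_dim nu2 q) 1) &
        (forall S : set R, compact S -> S `<=` [set s | 0 < s] ->
          {uniform S,
            (fun (n : nat) (s : R) =>
              - (log2 (Lq_sum (convolution nu1 (dilate s nu2)) q n)
                 / ((q - 1) * n%:R))) @ \oo
            --> (fun _ : R => Num.min (Lq_dim nu1 q + Lq_dim nu2 q) 1)})].
Proof.
move=> nu1 nu2 q /andP[q1 q2].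
have b_gt0 : 0 < b by exact: lt_trans a_lt_b.
have a_lt1 : a < 1 by exact: lt_trans b_lt1.
have l2 : 0 < ln (2 : R) by rewrite ln_gt0// ltr1n.
have mu0 : 0 < (q - 1) * ln (2 : R) by rewrite mulr_gt0 ?subr_gt0.
have [E1_gt0 [l1 rate1]] := projection_rate t a_gt0 a_lt1 q1 nubar1_sub.
have [E2_gt0 [l2' rate2]] := projection_rate u b_gt0 b_lt1 q1 nubar2_sub.
have cvg1 := Lq_quotient_cvg q1 rate1; have cvg2 := Lq_quotient_cvg q1 rate2.
have D1 : Lq_dim nu1 q = - l1 / ((q - 1) * ln 2) by exact: cvg_lim.
have D2 : Lq_dim nu2 q = - l2' / ((q - 1) * ln 2) by exact: cvg_lim.
pose lam := Num.min (- (l1 + l2')) ((q - 1) * ln 2).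
have DE : Num.min (Lq_dim nu1 q + Lq_dim nu2 q) 1 = - - lam / ((q - 1) * ln 2).
  rewrite D1 D2 opprK /lam minr_pMl ?invr_ge0 ?(ltW mu0)// divff ?gt_eqF//.
  by congr (Num.min _ _); field; rewrite !gt_eqF// subr_gt0.
have irr' : @irrational R (ln a / ln b).
  rewrite (_ : ln a / ln b = log2 a / log2 b)//.
  rewrite /log2; field; rewrite gt_eqF//= -oppr_eq0 gt_eqF//.
  by rewrite oppr_gt0 ln_lt0// b_gt0.
pose E := conv_sum a b t u nubar1 nubar2 q.
have E_gt0 (s : R) n : 0 <= s -> 0 < E s n.
  move=> s0; apply: (conv_sum_gt0 t u nubar1 nubar2 a_gt0 a_lt1 b_gt0 b_lt1 q1 s0 n).
  by rewrite s0 lexx.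
have rate (s1 s2 e : R) : 0 < s1 -> 0 < e -> exists N : nat, forall n s,
  (N <= n)%N -> s1 <= s <= s2 -> `|ln (E s n) - - lam * n%:R| <= e * n%:R.
  move=> s10 e0.
  have Eup := fun (Sg : R) (Sg0 : 0 <= Sg) =>
    conv_sum_upper t u nubar1 nubar2 Sg a_gt0 a_lt1 b_gt0 b_lt1 q1.
  have Elow := fun (Sg : R) (Sg0 : 0 <= Sg) =>
    conv_sum_lower t u nubar1 nubar2 a_gt0 a_lt1 b_gt0 b_lt1 q1 Sg0.
  have Eprod := fun (Sg : R) (Sg0 : 0 <= Sg) =>
    conv_sum_ge_product t u nubar1 nubar2 Sg a_gt0 a_lt1 b_gt0 b_lt1 q1.
  have Ecoc := fun (Sg : R) (Sg0 : 0 <= Sg) =>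
    conv_sum_cocycle t u Sg a_gt0 a_lt1 b_gt0 b_lt1 q1 nubar1_sub nubar2_sub.
  have Emean := fun (Sg c0 : R) (Sg0 : 0 <= Sg) (c00 : 0 < c0) =>
    conv_sum_mean t u nubar1 nubar2 a_gt0 a_lt1 b_gt0 b_lt1 q1 q2 Sg0 c00.
  have [N hN] := uniform_rate a_gt0 a_lt_b b_lt1 irr' E_gt0 E1_gt0 E2_gt0
    Eup Elow Eprod Ecoc Emean rate1 rate2 s2 s10 e0.
  by exists N => n s Nn sS; rewrite mulNr opprK; exact: hN.
split.
- by apply/cvg_ex; exists (- l1 / ((q - 1) * ln 2)).
- by apply/cvg_ex; exists (- l2' / ((q - 1) * ln 2)).
- move=> s s0.
  have cvgs : Lq_quotient (convolution nu1 (dilate s nu2)) q n @[n --> \oo] -->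
      - - lam / ((q - 1) * ln 2).
    apply: Lq_quotient_cvg => // e e0; have [N hN] := rate s s e s0 e0.
    by exists N => n Nn; apply: hN; rewrite // lexx.
  split; first by apply/cvg_ex; exists (- - lam / ((q - 1) * ln 2)).
  by rewrite DE; exact: cvg_lim.
move=> S cS Spos; rewrite DE.
have [s1 [s2 [s10 Ss]]] := compact_pos_bounds cS Spos.
move=> Q /uniform_nbhs [V [entV VQ]].
move: entV; rewrite -entourage_ballE => -[e /= e0 eV].
have [N hN] := rate s1 s2 _ s10 (mulr_gt0 (divr_gt0 e0 (ltr0n R 2)) mu0).
exists N.+1 => // n /= Nn; apply: VQ => s /Ss sS /=; apply: eV.
have n0 : (0 < n)%N by apply: leq_trans Nn.
rewrite /ball /= distrC.
have := log2_quotient_dist q1 n0 (hN n s (ltnW Nn) sS).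
rewrite mulfK ?gt_eqF// => h.
rewrite -mulrN -invrN [(q - 1) * n%:R]mulrC; apply: (le_lt_trans h).
by rewrite ltr_pdivrMr// ltr_pMr// ltr1n.
Qed.
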